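(* Let $\mathcal{F}=(m_{i,j})$ be an $n$-periodic infinite frieze pattern of Type $\Lambda_{p_1,\ldots,p_s}$ realized by a dissection $\mathcal{D}$ of $A_{n,m}$ or $S_n$, and let $s_1=m_{0,n+1}-m_{1,n}$ be its principal growth coefficient. Then for every $i\in\mathbb{Z}$, $s_1=\sum_{w\in\mathcal{M}_{i,i+n+1}}wt_A(w)$.
   Context: Frieze pattern: array $(m_{i,j})_{j\ge i}$ of reals with $m_{i,i}=0$, $m_{i,i+1}=1$, $m_{i-1,j}m_{i,j+1}-m_{i,j}m_{i+1,j+1}=1$, all $j\ge i$ (infinite); $n$-periodic quiddity row $m_{i-1,i+1}$. For such patterns $m_{i,i+n+1}-m_{i+1,i+n}$ is independent of $i$ (a known result). $\lambda_p=2\cos(\pi/p)$; Type $\Lambda_{p_1,\ldots,p_s}$: quiddity entries are sums of positive integer multiples of $\lambda_{p_1},\ldots,\lambda_{p_s}$. $U_{-1}=0$, $U_0=1$, $U_k(x)=xU_{k-1}(x)-U_{k-2}(x)$. $A_{n,m}$: annulus with $n$ outer and $m$ inner marked points; $S_n$: disc with $n$ boundary marked points and a puncture; a dissection is a set of non-crossing arcs between marked points dividing the surface into polygons (subgons), no arc joining two inner points. Outer vertices $v_1,\ldots,v_n$ counterclockwise; $\mathcal{D}$ realizes $\mathcal{F}$ if $m_{i-1,i+1}=\sum\lambda_{|\mathcal{P}|}$ over subgons incident to $v_i$ (counted by corners). Universal cover $I$: for $A_{n,m}$, cut along a bridging arc and glue $\mathbb{Z}$ copies along it, giving a dissected infinite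 strip with lower marked points $u_i$ ($i\in\mathbb{Z}$) over $v_{i\bmod n}$; for $S_n$, a strip with lower points $u_i$ and a point $+\infty$, arcs from $v_a$ to the puncture lifting to arcs from all $u_i$, $i\equiv a$, to $+\infty$, the regions between them dissected as in $S_n$. The covering map $\rho$ sends each subgon of $I$ to a subgon of $\mathcal{D}$ of the same size (its lifts), and subgons incident to $u_i$ correspond to corners at $v_{i\bmod n}$. $\mathcal{M}_{i,i+n+1}$: matchings $w=(\mathcal{P}_{i+1},\ldots,\mathcal{P}_{i+n})$ with $\mathcal{P}_k$ a subgon of $I$ incident to $u_k$. Annulus weight: for each subgon $\mathcal{P}$ of $\mathcal{D}$ let $N_{\mathcal{P}}$ be the number of $k$ with $\rho(\mathcal{P}_k)=\mathcal{P}$; $wt_A(w)=0$ if some $N_{\mathcal{P}}>|\mathcal{P}|-2$, else $wt_A(w)=\prod_{\mathcal{P}\in\mathcal{D}}U_{N_{\mathcal{P}}}(\lambda_{|\mathcal{P}|})$.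
   Formalization: The frieze rule is taken in its standard form m_{i-1,j}m_{i,j+1} − m_{i-1,j+1}m_{i,j} = 1; the form m_{i-1,j}m_{i,j+1} − m_{i,j}m_{i+1,j+1} = 1 would force adjacent quiddity entries to have product 2, which no dissection realizes. *)

(* Defs.v *)
From HB Require Import structures.
From mathcomp Require Import all_boot all_order all_algebra.
From mathcomp Require Import all_classical all_reals all_analysis.

Set Implicit Arguments.
Unset Strict Implicit.
Unset Printing Implicit Defensive.
Import Order.TTheory GRing.Theory Num.Theory.
Local Open Scope classical_set_scope.
Local Open Scope ring_scope.

(** * Frieze patterns *)

(* Only the entries [F i j] with [i <= j] are meaningful. *)
Definition frieze_pattern (R : realType) (F : int -> int -> R) : Prop :=
  [/\ forall i, F i i = 0,
      forall i, F i (i + 1) = 1 &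
      forall i j, i <= j ->
        F (i - 1) j * F i (j + 1) - F (i - 1) (j + 1) * F i j = 1].

Definition quiddity (R : realType) (F : int -> int -> R) (i : int) : R :=
  F (i - 1) (i + 1).

Definition periodic_quiddity (R : realType) (n : nat) (F : int -> int -> R) :
    Prop :=
  forall i, quiddity F (i + n%:Z) = quiddity F i.

Definition lambda (R : realType) (p : nat) : R := 2 * cos (pi / p%:R).

(* Each entry is a nonempty sum of positive multiples of some of the
   [lambda (p j)]; the indices [j] with [c j = 0] are those not used. *)
Definition type_Lambda (R : realType) (s : nat) (p : 'I_s -> nat)
    (F : int -> int -> R) : Prop :=
  forall i, exists c : 'I_s -> nat,
    (exists j, (0 < c j)%N) /\
    quiddity F i = \sum_(j < s) (c j)%:R * lambda R (p j).

Definition principal_growth (R : realType) (n : nat) (F : int -> int -> R) : R :=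
  F 0 (n%:Z + 1) - F 1 n%:Z.

(* The convention [U_(-1) = 0] is the innermost [0]. *)
Fixpoint chebU (R : realType) (k : nat) (x : R) {struct k} : R :=
  if k is k'.+1 then
    x * chebU k' x - (if k' is k''.+1 then chebU k'' x else 0)
  else 1.

(** * Marked surfaces and their universal covers *)

(* [Annulus n m] is A_{n,m}; [PuncturedDisc n] is S_n. *)
Variant surface := Annulus of nat & nat | PuncturedDisc of nat.

(* Marked points of the covering strip: lower points u_i, upper points (over the
   inner boundary of the annulus), and the point +oo (over the puncture). *)
Variant mpoint := Low of int | Up of int | PInf.

Definition mpoint_code (x : mpoint) : int + option int :=
  match x with Low i => inl i | Up j => inr (Some j) | PInf => inr None end.
Definition mpoint_decode (x : int + option int) : mpoint :=
  match x with inl i => Low i | inr (Some j) => Up j | inr None => PInf end.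
Lemma mpoint_codeK : cancel mpoint_code mpoint_decode.
Proof. by case. Qed.
HB.instance Definition _ := Countable.copy mpoint (can_type mpoint_codeK).

Definition marked (sf : surface) (x : mpoint) : bool :=
  match sf, x with
  | _, Low _ => true
  | Annulus _ _, Up _ => true
  | PuncturedDisc _, PInf => true
  | _, _ => false
  end.

Definition inner (x : mpoint) : bool := if x is Low _ then false else true.

(* The order in which the marked points are met when going once around the
   boundary of the strip: the lower points from left to right, then the upper
   points from right to left (or +oo). *)
Definition bord (x y : mpoint) : bool :=
  match x, y with
  | Low i, Low j => i < j
  | Low _, _ => true
  | Up i, Up j => j < i
  | _, _ => false
  end.

(* The [k]-th power of the generator of the deck group of the cover. *)
Definition deck (sf : surface) (k : int) (x : mpoint) : mpoint :=
  match sf, x with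
  | Annulus n _, Low i => Low (i + k * n%:Z)
  | Annulus _ m, Up j => Up (j + k * m%:Z)
  | PuncturedDisc n, Low i => Low (i + k * n%:Z)
  | _, _ => x
  end.

(* Segments of the boundary of the strip, with endpoints in [bord]-order. *)
Definition bsegment (sf : surface) (x y : mpoint) : bool :=
  match sf, x, y with
  | _, Low i, Low j => j == i + 1
  | Annulus _ _, Up i, Up j => i == j + 1
  | _, _, _ => false
  end.

(** * Dissections *)

(* An arc of the surface, up to isotopy, is the deck orbit of a pair of marked
   points of the strip; hence a set of arcs is a deck-invariant set of pairs,
   each pair being listed in [bord]-order. *)
Definition crosses (a b : mpoint * mpoint) : bool :=
  [&& bord a.1 b.1, bord b.1 a.2 & bord a.2 b.2]
  || [&& bord b.1 a.1, bord a.1 b.2 & bord b.2 a.2].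

Definition edge (sf : surface) (D : set (mpoint * mpoint)) (x y : mpoint) :
    Prop :=
  bsegment sf x y \/ D (x, y).

(* The polygons cut out in the strip by the lifted arcs, given by their
   vertices in [bord]-order: consecutive vertices (cyclically) are joined by an
   arc or a boundary segment, and no arc is a diagonal of the polygon. *)
Definition subgon (sf : surface) (D : set (mpoint * mpoint)) (P : seq mpoint) :
    Prop :=
  [/\ (3 <= size P)%N,
      sorted bord P,
      forall k, (k.+1 < size P)%N -> edge sf D (nth PInf P k) (nth PInf P k.+1),
      edge sf D (head PInf P) (last PInf P) &
      forall k l, (k.+1 < l)%N -> (l < size P)%N ->
        (k, l) <> (0%N, (size P).-1) -> ~ D (nth PInf P k, nth PInf P l)].

(* A polygon with the arc [(x, y)] as an edge lies inside (resp. outside) when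
   its other vertices lie between [x] and [y] (resp. before [x] or after [y]).
   The last two fields say that the arcs divide the surface into polygons: there
   is a polygon on each side of every arc, and on the side of every boundary
   segment that faces the surface. *)
Record is_dissection (sf : surface) (D : set (mpoint * mpoint)) : Prop := {
  arc_marked : forall x y, D (x, y) ->
    [/\ marked sf x, marked sf y, bord x y & ~~ bsegment sf x y] ;
  arc_not_inner : forall x y, D (x, y) -> ~~ (inner x && inner y) ;
  arc_deck : forall k x y, D (x, y) -> D (deck sf k x, deck sf k y) ;
  arc_noncrossing : forall a b, D a -> D b -> ~~ crosses a b ;
  polygon_inside : forall x y, D (x, y) ->
    exists P, [/\ subgon sf D P, x \in P, y \in P &
      exists2 z, z \in P & bord x z && bord z y] ;
  polygon_outside : forall x y, edge sf D x y ->
    exists P, [/\ subgon sf D P, x \in P, y \in P &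
      exists2 z, z \in P & bord z x || bord y z]
}.

(* The covering map on subgons: the subgon of the surface below [P], identified
   with the set of its lifts. *)
Definition rho (sf : surface) (P : seq mpoint) : set (seq mpoint) :=
  [set Q | exists k : int, Q = map (deck sf k) P].

Definition subgons (sf : surface) (D : set (mpoint * mpoint)) :
    set (set (seq mpoint)) :=
  [set rho sf P | P in [set P | subgon sf D P]].

(* All the lifts of a subgon have the same size; [xget] picks one of them. *)
Definition gon_size (C : set (seq mpoint)) : nat := size (xget [::] C).

(* The subgons of the strip at u_i, i.e. the corners at v_(i mod n) of the
   subgons of the surface. *)
Definition subgons_at (sf : surface) (D : set (mpoint * mpoint)) (i : int) :
    set (seq mpoint) :=
  [set P | subgon sf D P /\ Low i \in P].

Definition realizes (R : realType) (sf : surface) (D : set (mpoint * mpoint))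
    (F : int -> int -> R) : Prop :=
  forall i, quiddity F i = \sum_(P \in subgons_at sf D i) lambda R (size P).

(** * Matchings and annulus weights *)

(* [w k] is the subgon matched with u_(i + 1 + k). *)
Definition matchings (n : nat) (sf : surface) (D : set (mpoint * mpoint))
    (i : int) : set {ffun 'I_n -> seq mpoint} :=
  [set w | forall k : 'I_n, subgons_at sf D (i + 1 + (k : nat)%:Z) (w k)].

Definition mult (n : nat) (sf : surface) (w : {ffun 'I_n -> seq mpoint})
    (C : set (seq mpoint)) : nat :=
  #|[pred k : 'I_n | rho sf (w k) == C]|.

Definition wtA (R : realType) (n : nat) (sf : surface)
    (D : set (mpoint * mpoint)) (w : {ffun 'I_n -> seq mpoint}) : R :=
  if `[< exists2 C, subgons sf D C & (gon_size C - 2 < mult sf w C)%N >] then 0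
  else \big[*%R/1]_(C \in subgons sf D)
         chebU (mult sf w C) (lambda R (gon_size C)).

(* Main.v *)
Require Import Defs.
From HB Require Import structures.
From mathcomp Require Import all_boot all_order all_algebra.
From mathcomp Require Import all_classical all_reals all_analysis.
From mathcomp Require Import zify ring lra.

Set Implicit Arguments.
Unset Strict Implicit.
Unset Printing Implicit Defensive.
Import Order.TTheory GRing.Theory Num.Theory.
Local Open Scope classical_set_scope.
Local Open Scope ring_scope.

(** Call a polygon of the strip bridging if it has a vertex on the inner
    boundary (or the puncture), and low otherwise.

    Growth side.  Around a polygon with [p] vertices, a solution of
    [g (k+1) + g (k-1) = q_k g k] restricts to a Chebyshev sequence with
    parameter [lambda p], which changes sign after one turn.  Hence the increment
    of [g] at the end of an arc telescopes over the polygons below the arc, and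
    [g] restricted to the lower vertices of the bridging polygons satisfies the
    recurrence whose coefficients sum over bridging polygons only.  Both
    recurrences have the same monodromy on solutions, so by Cayley-Hamilton the
    same trace.  Frieze patterns are determined by the quiddity row because the
    continuants are positive, which is again read off the bridging vertices.

    Matching side.  Since [U_(p-2)(lambda p) = 1] and weights with more than
    [p-2] choices vanish, a matching of nonzero weight must choose a low polygon
    at each of its interior points and nowhere else.  What remains is a sum over
    choices of bridging polygons, and [U_(k+1) = x U_k - U_(k-1)] turns it into
    the trace of the reduced recurrence. *)

(** * Chebyshev polynomials at [lambda p] *)

(** The obstacle is that [wtA] counts choices on the surface, where different lifts of a subgon are
    identified, while the recurrences live in the strip. Between a bridging arc and its translate
    every subgon has at most one lift, so counting there is honest; the price is that the vertex at
    the cut is split into two halves. A bridging polygon at the cut vertex may be chosen again at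
    the right or at the left end of the period, and these two corrections are what turn a single
    continuant into a trace. The truncation of weights costs nothing on bridging polygons: an inner
    vertex leaves at most p - 1 choices, and U_(p-1)(lambda p) = 0. On low polygons it is decisive:
    by induction on length, one chosen at an end point would be chosen at all its interior points
    too, which is once too often. Positivity serves twice: the frieze rule gives the next entry only
    after division by an earlier one, and two recurrences sharing a solution give equal traces only
    after a nonzero value of it is cancelled. *)

Section Chebyshev.
Variable R : realType.

Lemma chebUS k (x : R) : chebU k.+2 x = x * chebU k.+1 x - chebU k x.
Proof. by []. Qed.

Lemma sin_natSS (t : R) k :
  sin (k.+2%:R * t) = 2 * cos t * sin (k.+1%:R * t) - sin (k%:R * t).
Proof.
have -> : k.+2%:R * t = k.+1%:R * t + t by rewrite -[k.+2]addn1 natrD; ring.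
have -> : k%:R * t = k.+1%:R * t - t by rewrite -[k.+1]addn1 natrD; ring.
by rewrite sinD sinB; ring.
Qed.

Lemma chebU_sin (t : R) k : chebU k (2 * cos t) * sin t = sin (k.+1%:R * t).
Proof.
suff: chebU k (2 * cos t) * sin t = sin (k.+1%:R * t) /\
      chebU k.+1 (2 * cos t) * sin t = sin (k.+2%:R * t) by case.
elim: k => [|k [IH1 IH2]].
  split; first by rewrite /= !mul1r.
  by rewrite /= sin_natSS !mul1r mul0r sin0; ring.
split=> //; rewrite chebUS [in RHS]sin_natSS -IH1 -IH2; ring.
Qed.

Variable p : nat.
Hypothesis p_gt2 : (2 < p)%N.
Let t : R := pi / p%:R.

Let p_gt0 : 0 < p%:R :> R. Proof. by rewrite ltr0n; apply: leq_trans p_gt2. Qed.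

Let sin_arg_gt0 k : (0 < k < p)%N -> 0 < sin (k%:R * t).
Proof.
move=> /andP[k0 kp]; apply: sin_gt0_pi; apply/andP; split.
  by rewrite mulr_gt0 ?ltr0n // divr_gt0 ?pi_gt0.
rewrite /t mulrCA -[ltRHS]mulr1 ltr_pM2l ?pi_gt0 // ltr_pdivrMr // mul1r.
by rewrite ltr_nat.
Qed.

Let sin_argC k : (k <= p)%N -> sin ((p - k)%:R * t) = sin (k%:R * t).
Proof.
move=> kp; rewrite natrB // mulrBl /t mulrCA divff ?gt_eqF // mulr1.
by rewrite sinB cospi sinpi mul0r mulN1r sub0r opprK.
Qed.

Let sin_t_gt0 : 0 < sin t.
Proof. by have := @sin_arg_gt0 1; rewrite mul1r; apply; rewrite /= ltnW. Qed.

Lemma chebU_lambda_gt0 k : (k < p.-1)%N -> 0 < chebU k (lambda R p).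
Proof.
move=> kp; rewrite -(pmulr_lgt0 _ sin_t_gt0) chebU_sin sin_arg_gt0 //; lia.
Qed.

Lemma chebU_lambda_ge0 k : (k < p)%N -> 0 <= chebU k (lambda R p).
Proof.
move=> kp; have [/chebU_lambda_gt0/ltW//|kp'] := ltnP k p.-1.
rewrite -(pmulr_lge0 _ sin_t_gt0) chebU_sin.
have -> : k.+1 = (p - 0)%N by lia.
by rewrite sin_argC // mul0r sin0.
Qed.

Lemma chebU_lambda_subn2 : chebU (p - 2) (lambda R p) = 1.
Proof.
apply: (mulIf (lt0r_neq0 sin_t_gt0)); rewrite chebU_sin.
have -> : (p - 2).+1 = (p - 1)%N by lia.
by rewrite sin_argC ?mul1r //; lia.
Qed.

Lemma chebU_lambda_subn1 : chebU (p - 1) (lambda R p) = 0.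
Proof.
apply: (mulIf (lt0r_neq0 sin_t_gt0)); rewrite chebU_sin.
have -> : (p - 1).+1 = (p - 0)%N by lia.
by rewrite sin_argC // mul0r sin0 mul0r.
Qed.

Variable g : nat -> R.
Hypothesis g_rec : forall j, (j.+2 < p)%N ->
  g j.+2 + g j = lambda R p * g j.+1.

(** The first conjunct is the second one at j - 1, with sin((j-1)t) expanded by the subtraction
    formula so that it makes sense at j = 0. *)
Let g_sin j : (j < p.-1)%N ->
  g j * sin t = g 1 * sin (j%:R * t) - g 0 * (sin (j%:R * t) * cos t - cos (j%:R * t) * sin t) /\
  g j.+1 * sin t = g 1 * sin (j.+1%:R * t) - g 0 * sin (j%:R * t).
Proof.
elim: j => [|j IH] jp.
  by rewrite !mul0r sin0 cos0 !mul1r; split; ring.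
have [IH1 IH2] := IH ltac:(lia); split.
  rewrite IH2; congr (_ - _ * _).
  by rewrite -sinB -[j.+1]addn1 natrD mulrDl mul1r addrK.
have -> : g j.+2 = lambda R p * g j.+1 - g j by rewrite -g_rec ?addrK //; lia.
rewrite mulrBl -mulrA IH2 IH1 sin_natSS.
have -> : sin (j.+1%:R * t) = sin (j%:R * t) * cos t + cos (j%:R * t) * sin t.
  by rewrite -sinD -[j.+1]addn1 natrD mulrDl mul1r.
rewrite /lambda -/t; ring.
Qed.

(* A Chebyshev sequence along a [p]-gon changes sign after one turn. *)
Lemma cheb_cycle_first : g 1 - lambda R p * g 0 = g p.-1.
Proof.
apply: (mulIf (lt0r_neq0 sin_t_gt0)).
have [|_] := @g_sin (p - 2); first by lia.
have -> : (p - 2).+1 = (p - 1)%N by lia.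
rewrite -subn1 => ->; rewrite !sin_argC; try lia.
by rewrite mul1r (sin_natSS t 0) mul1r mul0r sin0 /lambda -/t; ring.
Qed.

(** In terms of its two end values, g_j sin t = g_(p-1) sin(jt) + g_0 sin((j+1)t), and the sines are
    positive in the range where this is used. *)
Lemma cheb_interp_gt0 j : (0 < j < p)%N -> 0 <= g 0 -> 0 < g p.-1 -> 0 < g j.
Proof.
move=> /andP[j0 jp] g0 gp; have [->//|jp'] := eqVneq j p.-1.
rewrite -(pmulr_lgt0 _ sin_t_gt0).
have [|_] := @g_sin j.-1; first by lia.
have g1 : g 1 = g p.-1 + lambda R p * g 0 by rewrite -cheb_cycle_first subrK.
case: j j0 jp jp' => // j _ jp jp'.
rewrite [j.+1.-1]/= => ->; rewrite g1 /lambda -/t.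
have -> : (g p.-1 + 2 * cos t * g 0) * sin (j.+1%:R * t) - g 0 * sin (j%:R * t)
  = g p.-1 * sin (j.+1%:R * t) + g 0 * sin (j.+2%:R * t).
  by rewrite sin_natSS; ring.
apply: ltr_wpDr; last by rewrite mulr_gt0 // sin_arg_gt0 //; lia.
by rewrite mulr_ge0 // ltW // sin_arg_gt0 //; lia.
Qed.

End Chebyshev.

(** The recurrence is symmetric under reversal of the sequence. *)
Lemma cheb_cycle_last (R : realType) p (g : nat -> R) : (2 < p)%N ->
  (forall j, (j.+2 < p)%N -> g j.+2 + g j = lambda R p * g j.+1) ->
  g (p - 2)%N - lambda R p * g p.-1 = g 0.
Proof.
move=> p2 grec.
have := @cheb_cycle_first R p p2 (fun j => g (p.-1 - j)%N) _.
rewrite subnn subn0; have -> : (p.-1 - 1 = p - 2)%N by lia.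
apply=> j jp; have := grec (p.-1 - j.+2)%N ltac:(lia).
have -> : ((p.-1 - j.+2).+2 = p.-1 - j)%N by lia.
have -> : ((p.-1 - j.+2).+1 = p.-1 - j.+1)%N by lia.
by rewrite addrC.
Qed.

(** * Polygons of the strip *)

Definition bkey (x : mpoint) : int := if inner x then 1 else 0.
Definition zkey (x : mpoint) : int :=
  match x with Low i => i | Up j => - j | PInf => 0 end.

(* A total preorder that agrees with [bord] on the marked points of one
   surface; the lexicographic keys make it accessible to [lia]. *)
Definition blt (x y : mpoint) : bool :=
  (bkey x < bkey y) || ((bkey x == bkey y) && (zkey x < zkey y)).

Definition between (x y z : mpoint) : bool := ~~ blt z x && ~~ blt y z.
(** Both [within] and [without] admit the end points, so a polygon may have the arc as an edge on
    either side; three vertices make the two exclusive. *)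
Definition within (x y : mpoint) (P : seq mpoint) : bool := all (between x y) P.
Definition without (x y : mpoint) (P : seq mpoint) : bool :=
  all (fun z => ~~ (blt x z && blt z y)) P.

Definition is_bridging (P : seq mpoint) : bool := has inner P.

Ltac nlia := repeat match goal with
  | H : context [blt] |- _ => clear H
  | H : context [between] |- _ => clear H
  | H : context [edge] |- _ => clear H end; lia.
Ltac blia := unfold between, blt in *; cbn [bkey zkey inner] in *; lia.

Notation pt := (nth PInf).

Lemma mem_pt (P : seq mpoint) i : (i < size P)%N -> pt P i \in P.
Proof. exact: mem_nth. Qed.

Lemma mem_ptP (P : seq mpoint) z :
  z \in P -> exists2 i, (i < size P)%N & pt P i = z.
Proof. by move/(nthP PInf). Qed.

Lemma withinP x y P : reflect (forall z, z \in P -> between x y z) (within x y P).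
Proof. exact: allP. Qed.

Lemma withoutP x y P :
  reflect (forall z, z \in P -> ~~ (blt x z && blt z y)) (without x y P).
Proof. exact: allP. Qed.

Section Order.
Variable sf : surface.

Lemma bordE x y : marked sf x -> marked sf y -> bord x y = blt x y.
Proof. by case: sf => [? ?|?]; case: x => [i|i|]; case: y => [j|j|]; rewrite /blt //=; lia. Qed.

Lemma key_inj x y : marked sf x -> marked sf y ->
  ~~ blt x y -> ~~ blt y x -> x = y.
Proof.
by case: sf => [? ?|?]; case: x => [i|i|]; case: y => [j|j|] //= _ _;
   rewrite /blt /= => H1 H2; congr (_ _); lia.
Qed.

Lemma bsegment_marked x y : bsegment sf x y -> marked sf x /\ marked sf y.
Proof. by case: sf => [? ?|?]; case: x => [i|i|]; case: y => [j|j|]. Qed.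

Lemma bsegment_lt x y : bsegment sf x y -> blt x y.
Proof.
by case: sf => [? ?|?]; case: x => [i|i|]; case: y => [j|j|] //=;
   rewrite /blt /=; lia.
Qed.

Lemma bsegment_tight x y z : bsegment sf x y -> marked sf z ->
  ~~ (blt x z && blt z y).
Proof.
by case: sf => [? ?|?]; case: x => [i|i|]; case: y => [j|j|] //=;
   case: z => [k|k|] //=; rewrite /blt /=; lia.
Qed.

End Order.

Lemma locate (P : seq mpoint) z :
  (forall i j, (i < j < size P)%N -> blt (pt P i) (pt P j)) ->
  (0 < size P)%N -> ~~ blt z (pt P 0) -> ~~ blt (pt P (size P).-1) z ->
  (exists2 i, (i < size P)%N & ~~ blt (pt P i) z && ~~ blt z (pt P i)) \/
  (exists2 i, (i.+1 < size P)%N & blt (pt P i) z && blt z (pt P i.+1)).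
Proof.
move=> srt P0 z0 zl; set a := find (fun t => ~~ blt t z) P.
have hasa : has (fun t => ~~ blt t z) P.
  by apply/hasP; exists (pt P (size P).-1) => //; apply: mem_pt; lia.
have aP : (a < size P)%N by rewrite -has_find.
have Ha : ~~ blt (pt P a) z by exact: (nth_find PInf hasa).
have [za|za] := boolP (blt z (pt P a)); last by left; exists a; rewrite ?Ha.
case ea: a => [|a']; first by move: za; rewrite ea (negbTE z0).
right; exists a'; first by rewrite -ea.
rewrite -ea za andbT.
by have := @before_find _ PInf (fun t => ~~ blt t z) P a' ltac:(by rewrite -/a ea) => /negbFE.
Qed.

Section Polygons.
Variables (sf : surface) (D : set (mpoint * mpoint)).
Hypothesis hD : is_dissection sf D.

Lemma edge_marked x y : edge sf D x y -> marked sf x /\ marked sf y.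
Proof.
by move=> [/bsegment_marked //|/(arc_marked hD)[]].
Qed.

Lemma edge_lt x y : edge sf D x y -> blt x y.
Proof.
move=> [/bsegment_lt //|/(arc_marked hD)[mx my]].
by rewrite (bordE mx my).
Qed.

(** No marked point lies strictly between the ends of a boundary segment, so only two genuine arcs
    could cross. *)
Lemma edge_nocross x y u v : edge sf D x y -> edge sf D u v ->
  ~~ [&& blt x u, blt u y & blt y v].
Proof.
move=> exy euv.
have [mx my] := edge_marked exy; have [mu mv] := edge_marked euv.
case: exy => [s|dxy].
  by apply: contra (bsegment_tight s mu) => /and3P[-> -> _].
case: euv => [s|duv].
  by apply: contra (bsegment_tight s my) => /and3P[_ -> ->].
have := arc_noncrossing hD dxy duv; rewrite /crosses /= !(@bordE sf) //.
by rewrite negb_or => /andP[].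
Qed.

Section OnePolygon.
Variable P : seq mpoint.
Hypothesis hP : subgon sf D P.

Lemma subgon_size : (2 < size P)%N. Proof. by case: hP. Qed.

Lemma subgon_edge i : (i.+1 < size P)%N -> edge sf D (pt P i) (pt P i.+1).
Proof. by case: hP => _ _ H _ _; apply: H. Qed.

Lemma subgon_base : edge sf D (pt P 0) (pt P (size P).-1).
Proof. by case: hP => _ _ _ H _; rewrite nth0 nth_last. Qed.

Lemma subgon_marked z : z \in P -> marked sf z.
Proof.
move=> /mem_ptP[i iP <-]; have := subgon_size.
case: i iP => [|i] iP sP; first by case: (edge_marked subgon_base).
by case: (edge_marked (subgon_edge iP)).
Qed.

Lemma pt_marked i : (i < size P)%N -> marked sf (pt P i).
Proof. by move=> iP; apply: subgon_marked; apply: mem_pt. Qed.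

Lemma pt_lt i j : (i < j < size P)%N -> blt (pt P i) (pt P j).
Proof.
elim: j => [|j IH] /andP[]; first by [].
move=> ij jP; have := edge_lt (subgon_edge jP).
have [->//|nij] := eqVneq i j.
have ij' : (i < j < size P)%N by lia.
have := IH ij'; clear; blia.
Qed.

Lemma pt_ltE i j : (i < size P)%N -> (j < size P)%N ->
  blt (pt P i) (pt P j) = (i < j)%N.
Proof.
move=> iP jP; have [ij|ji|->] := ltngtP i j.
- by rewrite pt_lt // ij.
- by have := @pt_lt j i; rewrite ji => /(_ iP) H; apply/negbTE; blia.
- by apply/negbTE; blia.
Qed.

Lemma pt_inj i j : (i < size P)%N -> (j < size P)%N -> pt P i = pt P j -> i = j.
Proof.
move=> iP jP e; have := pt_ltE iP jP; have := pt_ltE jP iP; rewrite e.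
have : ~~ blt (pt P j) (pt P j) by blia.
by move=> /negbTE ->; lia.
Qed.

Lemma subgon_uniq : uniq P.
Proof. by apply/(uniqP PInf) => i j iP jP; apply: pt_inj. Qed.

Lemma subgon_within : within (pt P 0) (pt P (size P).-1) P.
Proof.
apply/withinP => z /mem_ptP[i iP <-]; have := subgon_size.
by move=> ?; rewrite /between !pt_ltE; lia.
Qed.

Lemma subgon_locate z : marked sf z -> between (pt P 0) (pt P (size P).-1) z ->
  z \in P \/ exists2 i, (i.+1 < size P)%N & blt (pt P i) z && blt z (pt P i.+1).
Proof.
move=> mz /andP[z0 z1]; have sP := subgon_size.
have P0 : (0 < size P)%N by lia.
have [[i iP /andP[h1 h2]]|] := locate pt_lt P0 z0 z1.
  by left; rewrite -(key_inj (pt_marked iP) mz) // mem_pt.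
by right.
Qed.

End OnePolygon.

(** A polygon with vertices on both sides must enter and leave the region below the edge. By
    noncrossing it can do so only at [x] and [y], which makes the edge a diagonal of the polygon. *)
Lemma side x y P : edge sf D x y -> subgon sf D P -> within x y P \/ without x y P.
Proof.
move=> exy hP; have [mx my] := edge_marked exy; have sP := subgon_size hP.
have [|/allPn[u uP uout]] := boolP (within x y P); first by left.
have [|/allPn[v vP vin]] := boolP (without x y P); [by right|exfalso].
move: vin; rewrite negbK => vin.
have xy := edge_lt exy.
have mP i := @pt_marked P hP i.
have ltP i j := @pt_ltE P hP i j.
have [iu iuP eu] := mem_ptP uP; have [iv ivP ev] := mem_ptP vP.
rewrite /between -eu in uout; rewrite -ev in vin.
have l0 : ~~ blt (pt P iu) (pt P 0) by rewrite ltP; nlia.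
have l1 : ~~ blt (pt P (size P).-1) (pt P iu) by rewrite ltP; nlia.
(* [a] and [b.-1] are the first and last vertices strictly inside. *)
set a := find (blt x) P; set b := find (fun z => ~~ blt z y) P.
have hasa : has (blt x) P by apply/hasP; exists v => //; rewrite -ev; case/andP: vin.
have aP : (a < size P)%N by rewrite -has_find.
have xa : blt x (pt P a) by exact: nth_find.
have aiv : (a <= iv)%N.
  by rewrite leqNgt; apply/negP => /(@before_find _ PInf (blt x)); case/andP: vin => ->.
have ivb : (iv < b)%N.
  rewrite ltnNge; apply/negP => biv.
  have hasb : has (fun z => ~~ blt z y) P by rewrite has_find -/b; nlia.
  have yb : ~~ blt (pt P b) y by exact: (nth_find PInf hasb).
  have := ltP iv b ivP ltac:(nlia); blia.
have ay : blt (pt P a) y.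
  by have := @before_find _ PInf (fun z => ~~ blt z y) P a ltac:(nlia) => /negbFE.
have blast : blt (pt P b.-1) y.
  by have := @before_find _ PInf (fun z => ~~ blt z y) P b.-1 ltac:(nlia) => /negbFE.
have bleP : (b <= size P)%N by exact: find_size.
have nc := edge_nocross exy; have cn i (h : edge sf D i _) := edge_nocross h exy.
have a0 : (0 < a)%N.
  rewrite lt0n; apply/eqP => a0; rewrite a0 in xa ay.
  have := nc _ _ (subgon_base hP).
  move: l0 l1 uout xa ay xy; clear; blia.
have b1 : (b < size P)%N.
  rewrite ltn_neqAle bleP andbT; apply/eqP => b0; rewrite b0 in blast.
  have := cn _ _ (subgon_base hP).
  have l2 : ~~ blt (pt P (size P).-1) (pt P a) by rewrite ltP; nlia.
  move: l0 l1 l2 uout xa ay xy blast; clear; blia.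
have ea : pt P a.-1 = x.
  have xa1 : ~~ blt x (pt P a.-1).
    by rewrite (@before_find _ PInf (blt x) P a.-1) //; nlia.
  apply: (key_inj (mP _ _) mx) => //; first by nlia.
  apply/negP => h; have := @subgon_edge P hP a.-1; rewrite prednK // => /(_ aP) e.
  by have := edge_nocross e exy; rewrite h xa ay.
have eb : pt P b = y.
  have yb : ~~ blt (pt P b) y.
    by have := b1; rewrite -has_find => /(nth_find PInf).
  apply: (key_inj (mP _ _) my) => //.
  apply/negP => h; have := @subgon_edge P hP b.-1; rewrite prednK //; last by nlia.
  move=> /(_ b1) e.
  have := edge_nocross exy e; rewrite h blast andbT.
  have l2 : ~~ blt (pt P b.-1) (pt P a) by rewrite ltP; nlia.
  move: l2 xa; clear; blia.
have dxy : D (x, y).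
  case: exy => // /bsegment_tight /(_ (mP a aP)); by rewrite xa ay.
case: hP => _ _ _ _ /(_ a.-1 b); rewrite ea eb; apply=> //; first by nlia.
case=> h1 h2; move: uout; rewrite -ea -eb h1 h2 => /negP; apply.
by rewrite l0 l1.
Qed.

(** Each edge of [P] has [Q] on one side. If [Q] lies neither in a gap of [P] nor beyond its base,
    no vertex of [Q] falls strictly inside a gap, so the vertices of [Q] are vertices of [P]; the
    same argument backwards gives equality of the sorted lists. *)
Lemma nest P Q : subgon sf D P -> subgon sf D Q -> P <> Q ->
  (exists2 i, (i.+1 < size P)%N & within (pt P i) (pt P i.+1) Q) \/
  without (pt P 0) (pt P (size P).-1) Q.
Proof.
move=> hP hQ neq; apply: contrapT => /not_orP[nin nout]; apply: neq.
have sP := subgon_size hP; have sQ := subgon_size hQ.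
have inQ : within (pt P 0) (pt P (size P).-1) Q.
  by have [] := side (subgon_base hP) hQ.
have subQP z : z \in Q -> z \in P.
  move=> zQ; have mz := subgon_marked hQ zQ.
  have [//|[i iP zi]] := subgon_locate hP mz (withinP _ _ _ inQ _ zQ).
  have [wi|/withoutP/(_ _ zQ)] := side (subgon_edge hP iP) hQ; last by rewrite zi.
  by case: nin; exists i.
have subPQ z : z \in P -> z \in Q.
  move=> zP; have mz := subgon_marked hP zP.
  have Qin := @pt_ltE Q hQ.
  have [bz|nbz] := boolP (between (pt Q 0) (pt Q (size Q).-1) z).
    have [//|[i iQ zi]] := subgon_locate hQ mz bz.
    have [/withinP wP|/withoutP/(_ _ zP)] := side (subgon_edge hQ iQ) hP; last by rewrite zi.
    (* Here [P], and with it [Q], is confined to one gap of [Q], which leaves room for only two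
       vertices. *)
    have wt k : (k < size Q)%N -> between (pt Q i) (pt Q i.+1) (pt Q k).
      by move=> kQ; apply: wP; apply: subQP; apply: mem_pt.
    have Qw k : (k < size Q)%N -> (i <= k <= i.+1)%N.
      by move=> kQ; move: (wt k kQ); rewrite /between !Qin //; nlia.
    have := Qw 0%N ltac:(nlia); have := Qw 2%N ltac:(nlia); nlia.
  have [/withinP/(_ _ zP)|/withoutP wP] := side (subgon_base hQ) hP; first by rewrite (negbTE nbz).
  have : pt Q 1 \in P by apply: subQP; apply: mem_pt; nlia.
  by move=> /wP; rewrite !Qin; nlia.
have [_ srtP _ _ _] := hP; have [_ srtQ _ _ _] := hQ.
have [sz eqm] := uniq_min_size (subgon_uniq hP) subPQ (uniq_leq_size (subgon_uniq hQ) subQP).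
apply: (@irr_sorted_eq_in _ bord) => //.
- move=> y x z /(subgon_marked hP) my /(subgon_marked hP) mx /(subgon_marked hP) mz.
  by rewrite !(@bordE sf) //; clear; move=> h1 h2; blia.
- move=> x /(subgon_marked hP) mx; rewrite (@bordE sf) //; clear; apply/negbTE; blia.
Qed.

End Polygons.

(** * The deck group and the arcs between lower points *)

Section Deck.
Variable sf : surface.

Lemma bord_deck k x y : bord (deck sf k x) (deck sf k y) = bord x y.
Proof. by case: sf => [? ?|?]; case: x => [i|i|]; case: y => [j|j|] //=; lia. Qed.

Lemma bsegment_deck k x y : bsegment sf (deck sf k x) (deck sf k y) = bsegment sf x y.
Proof. by case: sf => [? ?|?]; case: x => [i|i|]; case: y => [j|j|] //=; lia. Qed.

Lemma deckD a b x : deck sf a (deck sf b x) = deck sf (a + b) x.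
Proof. by case: sf => [? ?|?]; case: x => [i|i|] //=; congr (_ _); ring. Qed.

Lemma deck0 x : deck sf 0 x = x.
Proof. by case: sf => [? ?|?]; case: x => [i|i|] //=; congr (_ _); ring. Qed.

Lemma deckK k : cancel (deck sf k) (deck sf (- k)).
Proof. by move=> x; rewrite deckD addNr deck0. Qed.

Lemma deck_inj k : injective (deck sf k).
Proof. exact: can_inj (deckK k). Qed.

Lemma inner_deck k x : inner (deck sf k x) = inner x.
Proof. by case: sf => [? ?|?]; case: x. Qed.

Lemma marked_deck k x : marked sf (deck sf k x) = marked sf x.
Proof. by case: sf => [? ?|?]; case: x. Qed.

Lemma map_deckD a b P :
  map (deck sf a) (map (deck sf b) P) = map (deck sf (a + b)) P.
Proof. by rewrite -map_comp; apply: eq_map => x /=; rewrite deckD. Qed.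

Lemma map_deck0 P : map (deck sf 0) P = P.
Proof. by rewrite -[RHS]map_id; apply: eq_map => x; rewrite deck0. Qed.

Lemma bridging_deck k P : is_bridging (map (deck sf k) P) = is_bridging P.
Proof. by rewrite /is_bridging has_map; apply: eq_has => x /=; rewrite inner_deck. Qed.

Lemma blt_deck k x y : marked sf x -> marked sf y ->
  blt (deck sf k x) (deck sf k y) = blt x y.
Proof.
move=> mx my; rewrite -!(@bordE sf) ?marked_deck //; exact: bord_deck.
Qed.

Variable D : set (mpoint * mpoint).
Hypothesis hD : is_dissection sf D.

Lemma edge_deck k x y : edge sf D x y -> edge sf D (deck sf k x) (deck sf k y).
Proof. by case=> [s|d]; [left; rewrite bsegment_deck|right; apply: arc_deck]. Qed.

Lemma subgon_deck k P : subgon sf D P -> subgon sf D (map (deck sf k) P).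
Proof.
move=> hP; have s3 := subgon_size hP; have [_ srt _ _ nodiag] := hP.
have nthm i : (i < size P)%N -> pt (map (deck sf k) P) i = deck sf k (pt P i).
  by move=> iP; rewrite (nth_map PInf).
split; rewrite ?size_map //.
- by rewrite sorted_map (eq_sorted (e' := bord)) // => x y /=; rewrite bord_deck.
- move=> i iP; rewrite !nthm //; last by lia.
  by apply: edge_deck; apply: subgon_edge.
- rewrite -nth0 -nth_last size_map !nthm; try lia.
  by apply: edge_deck; apply: subgon_base.
- move=> i j ij jP ne; rewrite !nthm; try lia.
  by move=> /(arc_deck hD (- k)); rewrite !deckK; apply: nodiag.
Qed.

End Deck.

Lemma low_vertex P z : ~~ is_bridging P -> z \in P -> exists i, z = Low i.
Proof. by move=> /hasPn h /h; case: z => // i _; exists i. Qed.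

Record strip_dissection (n : nat) (sf : surface) (D : set (mpoint * mpoint)) : Prop :=
  StripDissection {
    strip_gt0 : (0 < n)%N;
    strip_surface : (exists2 m, (0 < m)%N & sf = Annulus n m) \/ sf = PuncturedDisc n;
    strip_dissected : is_dissection sf D }.

(** * The lower boundary of the bridging polygons *)

Section Strip.
Variables (n : nat) (sf : surface) (D : set (mpoint * mpoint)).
Hypothesis H : strip_dissection n sf D.
#[local] Set Default Proof Using "All".
Let n_gt0 : (0 < n)%N := strip_gt0 H.
Let hsf := strip_surface H.
Let hD := strip_dissected H.

Lemma deckL k i : deck sf k (Low i) = Low (i + k * n%:Z).
Proof. by case: hsf => [[m _ ->]|->]. Qed.

Lemma mem_deck k i P : (Low i \in map (deck sf k) P) = (Low (i - k * n%:Z) \in P).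
Proof.
have -> : Low i = deck sf k (Low (i - k * n%:Z)) by rewrite deckL subrK.
by rewrite mem_map //; apply: deck_inj.
Qed.

(** An edge longer than one period would cross its own translate. *)
Lemma lowedge_span x y : edge sf D (Low x) (Low y) -> x < y <= x + n%:Z.
Proof.
move=> exy; have xy : x < y by have := edge_lt hD exy; rewrite /blt /=.
rewrite xy /= leNgt; apply/negP => yn.
have := edge_deck hD 1 exy; rewrite !deckL => e'.
by have := edge_nocross hD exy e'; rewrite /blt /=; lia.
Qed.

Lemma inside_polygon x y : D (x, y) ->
  exists P, [/\ subgon sf D P, pt P 0 = x & pt P (size P).-1 = y].
Proof.
move=> dxy; have exy : edge sf D x y by right.
have [mx my] := edge_marked hD exy.
have [P [hP xP yP [z zP]]] := polygon_inside hD dxy.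
have mz := subgon_marked hD hP zP; rewrite !(@bordE sf) // => xzy.
have [/withinP w|/withoutP/(_ _ zP)] := side hD exy hP; last by rewrite xzy.
have sP := subgon_size hP; have := subgon_within hD hP => /withinP w'.
have P0 : (0 < size P)%N by lia.
have P1 : ((size P).-1 < size P)%N by lia.
exists P; split=> //.
- apply: (key_inj (pt_marked hD hP P0) mx).
    by have /andP[] := w _ (mem_pt P0).
  by have /andP[] := w' _ xP.
- apply: (key_inj (pt_marked hD hP P1) my).
    by have /andP[] := w' _ yP.
  by have /andP[] := w _ (mem_pt P1).
Qed.

Lemma outside_polygon x y : edge sf D x y ->
  exists P, [/\ subgon sf D P, without x y P &
    exists2 i, (i.+1 < size P)%N & pt P i = x /\ pt P i.+1 = y].
Proof.
move=> exy; have [mx my] := edge_marked hD exy; have xy := edge_lt hD exy.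
have [P [hP xP yP [z zP]]] := polygon_outside hD exy.
have mz := subgon_marked hD hP zP; rewrite !(@bordE sf) // => zout.
have [/withinP/(_ _ zP)|wo] := side hD exy hP; first by rewrite /between; case/orP: zout => ->; rewrite ?andbF.
have [i iP ei] := mem_ptP xP; have [j jP ej] := mem_ptP yP.
have ij : (i < j)%N by rewrite -(pt_ltE hD hP) // ei ej.
exists P; split=> //; exists i; first by lia.
split=> //; have [ji|ji] := leqP j i.+1; first by have -> : i.+1 = j by lia.
have iP1 : (i.+1 < size P)%N by lia.
have /withoutP/(_ _ (mem_pt iP1)) := wo.
by rewrite -ei -ej !(pt_ltE hD hP) // ji ltnSn.
Qed.

(** The steps trace the lower boundary of the union of the bridging polygons; only low polygons lie
    below them. *)
Definition bstep (a b : int) : Prop := exists P, [/\ subgon sf D P, is_bridging P &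
  exists2 i, (i.+1 < size P)%N & pt P i = Low a /\ pt P i.+1 = Low b].

Definition bvertex (k : int) : Prop :=
  exists P, [/\ subgon sf D P, is_bridging P & Low k \in P].

Lemma bstep_edge a b : bstep a b -> edge sf D (Low a) (Low b).
Proof. by move=> [P [hP _ [i iP [<- <-]]]]; apply: subgon_edge. Qed.

(** Climb across the edge: the polygon beyond it is bridging, or it is low with a strictly longer
    base. Spans are bounded by [n], so the climb ends. *)
Lemma bstep_over x y : edge sf D (Low x) (Low y) ->
  exists a b, [/\ bstep a b, a <= x & y <= b].
Proof.
have [m] := ubnP (absz (x + n%:Z - y)%R); elim: m x y => // m IH x y mlt exy.
have /andP[xy yn] := lowedge_span exy.
have [P [hP _ [i iP [ei ej]]]] := outside_polygon exy.
have [br|nbr] := boolP (is_bridging P).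
  by exists x, y; split=> //; exists P; split=> //; exists i.
have sP := subgon_size hP.
have P0 : (0 < size P)%N by lia.
have P1 : ((size P).-1 < size P)%N by lia.
have [a ea] := low_vertex nbr (mem_pt P0); have [b eb] := low_vertex nbr (mem_pt P1).
have eab : edge sf D (Low a) (Low b) by rewrite -ea -eb; apply: subgon_base.
have := lowedge_span eab.
have iP' : (i < size P)%N by lia.
have := pt_ltE hD hP iP' P0; have := pt_ltE hD hP P1 iP; have := pt_ltE hD hP P0 iP'.
have := pt_ltE hD hP iP P1.
rewrite ei ej ea eb /blt /= => h1 h2 h3 h4 h5.
have [|a' [b' [st ? ?]]] := IH a b _ eab; first by lia.
by exists a', b'; split=> //; lia.
Qed.

(** A polygon with a vertex strictly below a low edge lies entirely below it and cannot reach the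
    inner boundary. *)
Lemma lowedge_cover a b k : edge sf D (Low a) (Low b) -> a < k < b -> ~ bvertex k.
Proof.
move=> eab akb [P [hP /hasP[z zP iz] kP]].
have [/withinP/(_ _ zP)|/withoutP/(_ _ kP)] := side hD eab hP.
  by move: iz; case: z {zP} => //=; rewrite /between /blt /= => *; lia.
by rewrite /blt /=; lia.
Qed.

Lemma bstep_bvertex a b : bstep a b -> bvertex a /\ bvertex b.
Proof.
move=> [P [hP br [i iP [ea eb]]]].
by split; exists P; split=> //; rewrite -?ea -?eb mem_pt //; lia.
Qed.

Lemma bstep_lt a b : bstep a b -> a < b.
Proof. by move=> /bstep_edge/lowedge_span/andP[]. Qed.

Lemma bstep_around k : exists a b, bstep a b /\ a <= k < b.
Proof.
have e : edge sf D (Low k) (Low (k + 1)) by left; case: (sf) => /= *; rewrite eqxx.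
have [a [b [st ? ?]]] := bstep_over e; exists a, b; split=> //; lia.
Qed.

Lemma bstep_next v : bvertex v -> exists w, bstep v w.
Proof.
move=> bv; have [a [b [st ab]]] := bstep_around v; exists b.
have [<-//|nav] := eqVneq a v.
by case: (lowedge_cover (k := v) (bstep_edge st)) => //; lia.
Qed.

Lemma bstep_gap a b k : bstep a b -> a < k -> bvertex k -> b <= k.
Proof.
move=> st ak bk; rewrite leNgt; apply/negP => kb.
by apply: (lowedge_cover (k := k) (bstep_edge st)) => //; rewrite ak.
Qed.

Lemma bstep_uniqr v w w' : bstep v w -> bstep v w' -> w = w'.
Proof.
move=> s1 s2; have [_ b1] := bstep_bvertex s1; have [_ b2] := bstep_bvertex s2.
have := bstep_gap s1 (bstep_lt s2) b2; have := bstep_gap s2 (bstep_lt s1) b1; lia.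
Qed.

Lemma bstep_uniql v w w' : bstep w v -> bstep w' v -> w = w'.
Proof.
move=> s1 s2; have [b1 _] := bstep_bvertex s1; have [b2 _] := bstep_bvertex s2.
have := bstep_lt s1; have := bstep_lt s2.
have [h|h|//] := ltgtP w w'.
- by have := bstep_gap s1 h b2; lia.
- by have := bstep_gap s2 h b1; lia.
Qed.

Lemma bvertex_deck k t : bvertex k -> bvertex (k + t * n%:Z).
Proof.
move=> [P [hP br kP]]; exists (map (deck sf t) P); split.
- exact: subgon_deck.
- by rewrite bridging_deck.
- by rewrite mem_deck addrK.
Qed.

Lemma bstep_deck a b t : bstep a b -> bstep (a + t * n%:Z) (b + t * n%:Z).
Proof.
move=> [P [hP br [i iP [ea eb]]]]; exists (map (deck sf t) P); split.
- exact: subgon_deck.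
- by rewrite bridging_deck.
- exists i; first by rewrite size_map.
  by rewrite !(nth_map PInf) ?ea ?eb ?deckL //; lia.
Qed.

(** A bridging arc along which the strip will be cut. *)
Definition bbase (v : int) (z : mpoint) : Prop := D (Low v, z) /\ inner z.

Lemma bbase_deck v z t : bbase v z -> bbase (v + t * n%:Z) (deck sf t z).
Proof.
by move=> [d iz]; split; rewrite ?inner_deck // -deckL; apply: arc_deck.
Qed.

Lemma bbase_bvertex v z : bbase v z -> bvertex v.
Proof.
move=> [/inside_polygon[P [hP e0 e1]] iz]; have sP := subgon_size hP.
exists P; split=> //; last by rewrite -e0 mem_pt //; lia.
by apply/hasP; exists z => //; rewrite -e1 mem_pt //; lia.
Qed.

(** In a bridging polygon the edge into its first inner vertex starts at a low vertex. No boundary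
    segment joins the two sides, so this edge is an arc. *)
Lemma bbase_exists : exists v z, bbase v z.
Proof.
have [a [b [[P [hP br [i iP [ea eb]]]] _]]] := bstep_around 0.
have jP : (find inner P < size P)%N by rewrite -has_find.
have ij : inner (pt P (find inner P)) by exact: nth_find.
case e: (find inner P) jP ij => [|j] jP ij.
  have sP := subgon_size hP; have P0 : (0 < size P)%N by lia.
  have iP' : (i < size P)%N by lia.
  move: (pt_ltE hD hP iP' P0) ij; rewrite ea.
  by case: (pt P 0) => // *; move: ea; lia.
have : ~~ inner (pt P j) by rewrite (@before_find _ PInf inner P j) // e.
have := subgon_edge hP jP; move: ij.
case: (pt P j) => // v; case: (pt P j.+1) => // [u|] _ ed _; exists v.
- by exists (Up u); split=> //; case: ed => //; case: (sf).
- by exists PInf; split=> //; case: ed => //; case: (sf).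
Qed.

Lemma bbase_shift v z k : bbase v z -> exists v' z', bbase v' z' /\ v' <= k < v' + n%:Z.
Proof.
move=> b; exists (v + ((k - v) %/ n%:Z)%Z * n%:Z), (deck sf ((k - v) %/ n%:Z)%Z z).
split; first exact: bbase_deck.
have n0 : n%:Z != 0 by lia.
have := divz_eq (k - v) n%:Z; have := modz_ge0 (k - v) n0.
have : 0 < n%:Z by lia.
move=> /(ltz_pmod (k - v)); lia.
Qed.

(** In boundary order all that lies to the right of a bridging arc is between its ends. Hence, for
    bridging arcs, [within] reads as right of the cut and [without] as left of it. *)
Lemma bbase_right v z k P : bbase v z -> subgon sf D P -> Low k \in P -> v < k ->
  within (Low v) z P.
Proof.
move=> [d iz] hP kP vk; have e : edge sf D (Low v) z by right.
have [//|/withoutP/(_ _ kP)] := side hD e hP.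
move=> h; move: h iz vk; clear; case: z => [?|?|] //=; rewrite /blt /=; lia.
Qed.

Lemma bbase_left v z k P : bbase v z -> subgon sf D P -> Low k \in P -> k < v ->
  without (Low v) z P.
Proof.
move=> [d iz] hP kP vk; have e : edge sf D (Low v) z by right.
have [/withinP/(_ _ kP)|//] := side hD e hP.
by move: vk; rewrite /between /blt /=; lia.
Qed.

End Strip.

(** * Choice sequences *)

Fixpoint choices (T : Type) (Ls : seq (seq T)) : seq (seq T) :=
  if Ls is L :: Ls' then [seq x :: s | x <- L, s <- choices Ls'] else [:: [::]].

Lemma mem_choices (T : eqType) (Ls : seq (seq T)) s :
  (s \in choices Ls) = all2 (fun x L => x \in L) s Ls.
Proof.
elim: Ls s => [|L Ls IH] [|x s] //=.
  by apply/negbTE/negP => /allpairsP[[? ?] [_ _ ?]].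
rewrite -IH; apply/allpairsP/andP => [[[y t] /= [yL tL [-> ->]]]//|[xL sL]].
by exists (x, s).
Qed.

Lemma choices_uniq (T : eqType) (Ls : seq (seq T)) :
  all uniq Ls -> uniq (choices Ls).
Proof.
elim: Ls => [|L Ls IH] //= /andP[uL /IH uLs].
by apply: allpairs_uniq => // -[x s] [y t] _ _ /= [-> ->].
Qed.

Lemma size_choice (T : eqType) (Ls : seq (seq T)) s :
  s \in choices Ls -> size s = size Ls.
Proof. by rewrite mem_choices; elim: Ls s => [|L Ls IH] [|x s] //= /andP[_ /IH ->]. Qed.

Lemma nth_choice (T : eqType) (x0 : T) (Ls : seq (seq T)) s i :
  s \in choices Ls -> (i < size Ls)%N -> nth x0 s i \in nth [::] Ls i.
Proof.
rewrite mem_choices; elim: Ls s i => [|L Ls IH] [|x s] //= [|i] /andP[xL sL] //.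
exact: IH.
Qed.

Lemma choices_nth (T : eqType) (x0 : T) (Ls : seq (seq T)) s :
  size s = size Ls ->
  (forall i, (i < size Ls)%N -> nth x0 s i \in nth [::] Ls i) -> s \in choices Ls.
Proof.
rewrite mem_choices; elim: Ls s => [|L Ls IH] [|x s] //= [sz] h.
by rewrite (h 0%N) // IH // => i iL; apply: (h i.+1).
Qed.

(** * Finiteness of the set of polygons at a lower vertex *)

Section Finite.
Variables (n : nat) (sf : surface) (D : set (mpoint * mpoint)).
Hypothesis H : strip_dissection n sf D.
#[local] Set Default Proof Using "All".
Let n_gt0 : (0 < n)%N := strip_gt0 H.
Let hsf := strip_surface H.
Let hD := strip_dissected H.

Let int_range (a b : int) : seq int := [seq a + i%:Z | i <- iota 0 (absz (b - a)%R).+1].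

Let mem_range a b k : a <= k <= b -> k \in int_range a b.
Proof.
move=> /andP[ak kb]; apply/mapP; exists (absz (k - a)%R); last by lia.
rewrite mem_iota /=; lia.
Qed.

Let boxed (E : seq mpoint) : finite_set
  [set P : seq mpoint | uniq P /\ {subset P <= E}].
Proof.
apply: (@sub_finite_set _ _ [set` flatten [seq choices (nseq s E) | s <- iota 0 (size E).+1]]); last exact: finite_seq.
move=> P [uP sPE].
suff : P \in flatten [seq choices (nseq s E) | s <- iota 0 (size E).+1] by [].
apply/flattenP; exists (choices (nseq (size P) E)).
  apply: (map_f (fun s => choices (nseq s E))).
  by rewrite mem_iota /= add0n ltnS uniq_leq_size.
apply: (choices_nth (x0 := PInf)); rewrite size_nseq // => i iP.
by rewrite nth_nseq iP; apply: sPE; apply: mem_nth.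
Qed.

(** The polygons at [k] are trapped between a lift of a bridging arc to the left of [k] and one to
    the right, so their vertices come from a finite box. *)
Lemma subgons_at_finite k : finite_set (subgons_at sf D k).
Proof.
have [v [z bv]] := bbase_exists H.
have [va [za [ba kva]]] := bbase_shift H (k - 1) bv.
have [vb [zb [bb kvb]]] := bbase_shift H (k + n%:Z) bv.
pose E := [seq Low i | i <- int_range va vb] ++
  [seq Up (- i) | i <- int_range (zkey zb) (zkey za)] ++ [:: PInf].
apply: (sub_finite_set _ (boxed E)).
move=> P /= [hP kP]; split; first exact: (subgon_uniq hD hP).
have /withinP wa := bbase_right H ba hP kP ltac:(lia).
have /withoutP wb := bbase_left H bb hP kP ltac:(lia).
have [_ ia] := ba; have [_ ib] := bb.
have mm := subgon_marked hD hP.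
have [da _] := ba; have [db _] := bb.
have [_ mza _ _] := arc_marked hD da; have [_ mzb _ _] := arc_marked hD db.
move=> x xP; suff : x \in E by [].
have mx := mm x xP; move: (wa x xP) (wb x xP); rewrite /E.
rewrite !mem_cat /between /blt; case: x {xP} mx => [i|j|] mx.
- move=> h1 h2; apply/orP; left; apply/mapP; exists i => //; apply: mem_range; move: h1 h2 ib ia; clear.
  by case: zb => //=; case: za => //= *; lia.
- move=> h1 h2; apply/orP; right; apply/orP; left; apply/mapP; exists (- j).
    apply: mem_range; move: h1 h2 ib ia mx mza mzb; clear.
    by case: zb => [?|?|] //=; case: za => [?|?|] //=; case: (sf) => //= *; lia.
  by rewrite opprK.
- by move=> _ _; rewrite (mem_head PInf [::]) !orbT.
Qed.

Definition gons (k : int) : seq (seq mpoint) := 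
  finmap.enum_fset (fset_set (subgons_at sf D k)).

Lemma gonsP k P : reflect (subgon sf D P /\ Low k \in P) (P \in gons k).
Proof.
have fin := subgons_at_finite k.
apply: (iffP idP) => [|h]; first by rewrite /gons in_fset_set // => /set_mem.
by rewrite /gons in_fset_set //; apply/mem_set.

Qed.

Lemma gons_uniq k : uniq (gons k).
Proof. exact: finmap.fset_uniq. Qed.

Lemma big_gons (R : realType) k (f : seq mpoint -> R) :
  \sum_(P \in subgons_at sf D k) f P = \sum_(P <- gons k) f P.
Proof. by rewrite fsbig_finite //; exact: subgons_at_finite. Qed.

End Finite.

Lemma big_condU (R : zmodType) (T : eqType) (s : seq T) (B B1 B2 : pred T) (f : T -> R) :
  (forall x, x \in s -> B x = B1 x || B2 x) ->
  (forall x, x \in s -> ~~ (B1 x && B2 x)) ->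
  \sum_(x <- s | B x) f x = \sum_(x <- s | B1 x) f x + \sum_(x <- s | B2 x) f x.
Proof.
move=> hU hI; rewrite big_mkcond [X in _ = X + _]big_mkcond [X in _ = _ + X]big_mkcond.
rewrite -big_split /=; apply: eq_big_seq => x xs; rewrite hU //.
by have := hI x xs; case: (B1 x); case: (B2 x) => //=; rewrite ?addr0 ?add0r.
Qed.

Lemma big_cond1 (R : zmodType) (T : eqType) (s : seq T) (a : T) (f : T -> R) :
  uniq s -> a \in s -> \sum_(x <- s | x == a) f x = f a.
Proof.
move=> us sa; rewrite big_mkcond (bigD1_seq a) //= eqxx big1 ?addr0 // => x.
by move=> /negbTE ->.
Qed.

(** * Polygons around a vertex *)

Section Gaps.
Variables (n : nat) (sf : surface) (D : set (mpoint * mpoint)).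
Hypothesis H : strip_dissection n sf D.
#[local] Set Default Proof Using "All".
Let hD := strip_dissected H.

Lemma within_without x y P : subgon sf D P -> within x y P -> ~~ without x y P.
Proof.
move=> hP /withinP w; apply/negP => /withoutP wo; have sP := subgon_size hP.
have P0 : (0 < size P)%N by lia.
have P1 : (1 < size P)%N by lia.
have P2 : (2 < size P)%N by lia.
move: (w _ (mem_pt P0)) (w _ (mem_pt P1)) (w _ (mem_pt P2)) (wo _ (mem_pt P1)).
have : blt (pt P 0) (pt P 1) by rewrite (pt_ltE hD hP).
have : blt (pt P 1) (pt P 2) by rewrite (pt_ltE hD hP).
clear; blia.
Qed.

Lemma within_gap P Q i k : subgon sf D P -> subgon sf D Q ->
  (i.+1 < size P)%N -> within (pt P i) (pt P i.+1) Q -> (k < size P)%N ->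
  pt P k \in Q -> k = i \/ k = i.+1.
Proof.
move=> hP hQ iP /withinP w kP /w; rewrite /between !(pt_ltE hD hP); lia.
Qed.

(** An interior vertex of [P] is not visible from beyond the base, so any other polygon there sits
    in one of the two gaps meeting at it. *)
Lemma gons_interior P Q i : subgon sf D P -> subgon sf D Q ->
  (i.+2 < size P)%N -> pt P i.+1 \in Q ->
  [\/ Q = P, within (pt P i) (pt P i.+1) Q | within (pt P i.+1) (pt P i.+2) Q].
Proof.
move=> hP hQ iP iQ; have [->|neq] := eqVneq Q P; first by constructor 1.
have [|[k kP w]|/withoutP/(_ _ iQ)] := @nest sf D hD P Q hP hQ; first by apply/eqP; rewrite eq_sym.
- have [e|e] := within_gap hP hQ kP w (ltnW iP) iQ.
    by constructor 3; rewrite e.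
  by constructor 2; case: e => ->.
- by have sP := subgon_size hP; rewrite !(pt_ltE hD hP); lia.
Qed.

Lemma gons_first P Q : subgon sf D P -> subgon sf D Q ->
  within (pt P 0) (pt P (size P).-1) Q -> pt P 0 \in Q ->
  Q = P \/ within (pt P 0) (pt P 1) Q.
Proof.
move=> hP hQ w iQ; have [->|neq] := eqVneq Q P; first by left.
have sP := subgon_size hP.
have [|[k kP w']|wo] := @nest sf D hD P Q hP hQ; first by apply/eqP; rewrite eq_sym.
- by have [|e|//] := within_gap hP hQ kP w' _ iQ; [lia|rewrite -e in w'; right].
- by have := within_without hQ w; rewrite wo.
Qed.

Lemma gons_last P Q : subgon sf D P -> subgon sf D Q ->
  within (pt P 0) (pt P (size P).-1) Q -> pt P (size P).-1 \in Q ->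
  Q = P \/ within (pt P (size P - 2)) (pt P (size P).-1) Q.
Proof.
move=> hP hQ w iQ; have [->|neq] := eqVneq Q P; first by left.
have sP := subgon_size hP.
have [|[k kP w']|wo] := @nest sf D hD P Q hP hQ; first by apply/eqP; rewrite eq_sym.
- have [|e|e] := within_gap hP hQ kP w' _ iQ; [lia|lia|].
  by right; rewrite e; have <- : k = (size P - 2)%N by lia.
- by have := within_without hQ w; rewrite wo.
Qed.

Lemma within_trans x y x' y' P : ~~ blt x' x -> ~~ blt y y' ->
  within x' y' P -> within x y P.
Proof.
move=> hx hy /withinP w; apply/withinP => z /w; move: hx hy; clear; blia.
Qed.

Lemma within_disjoint x y z Q : subgon sf D Q -> ~~ (within x y Q && within y z Q).
Proof.
move=> hQ; apply/negP => /andP[/withinP w1 /withinP w2].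
have sQ := subgon_size hQ.
have Q0 : (0 < size Q)%N by lia.
have Q1 : (1 < size Q)%N by lia.
move: (w1 _ (mem_pt Q0)) (w2 _ (mem_pt Q0)) (w1 _ (mem_pt Q1)) (w2 _ (mem_pt Q1)).
have : blt (pt Q 0) (pt Q 1) by rewrite (pt_ltE hD hQ).
clear; blia.
Qed.

Lemma within_segment x P : subgon sf D P -> ~~ within (Low x) (Low (x + 1)) P.
Proof.
move=> hP; apply/negP => /withinP w; have sP := subgon_size hP.
have P0 : (0 < size P)%N by lia.
have P1 : (1 < size P)%N by lia.
have P2 : (2 < size P)%N by lia.
move: (w _ (mem_pt P0)) (w _ (mem_pt P1)) (w _ (mem_pt P2)).
have : blt (pt P 0) (pt P 1) by rewrite (pt_ltE hD hP).
have : blt (pt P 1) (pt P 2) by rewrite (pt_ltE hD hP).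
clear; blia.
Qed.

Lemma gap_neq P i : subgon sf D P -> (i.+1 < size P)%N ->
  ~~ within (pt P i) (pt P i.+1) P.
Proof.
move=> hP iP; apply/negP => /withinP w; have sP := subgon_size hP.
have P0 : (0 < size P)%N by lia.
have P2 : (2 < size P)%N by lia.
move: (w _ (mem_pt P0)) (w _ (mem_pt P2)); rewrite /between !(pt_ltE hD hP); lia.
Qed.

Lemma low_pt P i : ~~ is_bridging P -> (i < size P)%N -> pt P i = Low (zkey (pt P i)).
Proof. by move=> lo iP; have [j ->] := low_vertex lo (mem_pt iP). Qed.

Lemma low_between P x y : pt P 0 = Low x -> pt P (size P).-1 = Low y ->
  subgon sf D P -> ~~ is_bridging P.
Proof.
move=> e0 e1 hP; apply/hasPn => z zP.
have := subgon_within hD hP => /withinP/(_ _ zP); rewrite e1 /between.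
by case: z zP => //= *; lia.
Qed.

Lemma within_low x y P : within (Low x) (Low y) P -> ~~ is_bridging P.
Proof.
by move=> /withinP w; apply/hasPn => z /w; rewrite /between; case: z => //= *; lia.
Qed.

(** The base of a low polygon cannot pass over a bridging vertex, so the polygon stays between [v]
    and one of the neighbouring bridging vertices. *)
Lemma low_gon_at u v w Q : bstep sf D u v -> bstep sf D v w -> subgon sf D Q ->
  Low v \in Q -> ~~ is_bridging Q ->
  within (Low u) (Low v) Q || within (Low v) (Low w) Q.
Proof.
move=> s1 s2 hQ vQ lo.
have lt1 := bstep_lt H s1; have lt2 := bstep_lt H s2.
have [bu' bv'] := bstep_bvertex H s1; have [_ bw'] := bstep_bvertex H s2.
have sQ := subgon_size hQ.
have Q0 : (0 < size Q)%N by lia.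
have Q1 : ((size Q).-1 < size Q)%N by lia.
have [a l0] := low_vertex lo (mem_pt Q0); have [c l1] := low_vertex lo (mem_pt Q1).
have eQ := subgon_base hQ; rewrite l0 l1 in eQ.
have wQ := subgon_within hD hQ; have /withinP/(_ _ vQ) := wQ.
rewrite l0 l1 /between /blt /= => hv.
have cov k : bvertex sf D k -> ~ (a < k < c).
  by move=> bk hk; apply: (lowedge_cover H eQ hk).
have cu := cov _ bu'; have cv := cov _ bv'; have cw := cov _ bw'.
have sp := lowedge_span H eQ.
have [hv0|hv0] := eqVneq v a.
  apply/orP; right.
  by apply: within_trans wQ; rewrite ?l0 ?l1 /blt /=; move: cw; lia.
apply/orP; left.
by apply: within_trans wQ; rewrite ?l0 ?l1 /blt /=; move: cu cv; lia.
Qed.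

End Gaps.

(** * Solutions of the recurrence of the quiddity row *)

Section Solutions.
Variables (R : realType) (n : nat) (sf : surface) (D : set (mpoint * mpoint)).
Hypothesis H : strip_dissection n sf D.
#[local] Set Default Proof Using "All".
Let hD := strip_dissected H.
Notation gons := (gons sf D).
Notation lam P := (lambda R (size P)).

Definition corner_sum (k : int) : R := \sum_(P <- gons k) lam P.

Definition arc_sum (k : int) (x y : int) : R :=
  \sum_(P <- gons k | within (Low x) (Low y) P) lam P.

Definition bridging_sum (k : int) : R := \sum_(P <- gons k | is_bridging P) lam P.

(** One-sided, so that a continuant row started at [b] and extended by absolute values qualifies. *)
Definition solution (b : int) (g : int -> R) : Prop :=
  forall k, b < k -> g (k + 1) + g (k - 1) = corner_sum k * g k.

Section OneSolution.
Variables (b : int) (g : int -> R).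
Hypothesis hg : solution b g.

(** Deleting the polygons below the arc makes [x] and [y] neighbours; the claim is that [g] still
    satisfies the recurrence of the reduced dissection at both ends. *)
Let arc_ok x y := edge sf D (Low x) (Low y) -> b <= x ->
  g (x + 1) - arc_sum x x y * g x = g y /\ g (y - 1) - arc_sum y x y * g y = g x.

(** The quiddity at an interior vertex splits into [P], the left gap and the right gap. The gap
    contributions replace the two neighbours of the vertex by the adjacent vertices of [P], leaving
    a Chebyshev recurrence. *)
Let polygon_rec P : subgon sf D P -> ~~ is_bridging P -> b <= zkey (pt P 0) ->
  (forall i, (i.+1 < size P)%N -> arc_ok (zkey (pt P i)) (zkey (pt P i.+1))) ->
  forall i, (i.+2 < size P)%N ->
  g (zkey (pt P i.+2)) + g (zkey (pt P i)) = lam P * g (zkey (pt P i.+1)).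
Proof.
move=> hP lo bP IH i iP.
have lowP j : (j < size P)%N -> pt P j = Low (zkey (pt P j)) by exact: (low_pt H).
have bj j : (j < size P)%N -> b <= zkey (pt P j).
  case: j => [|j] // jP; have sP := subgon_size hP.
  have P0 : (0 < size P)%N by lia.
  have := @pt_ltE sf D hD P hP 0%N j.+1 P0 jP; rewrite (lowP _ P0) (lowP _ jP) /blt /=; lia.
have e1 : edge sf D (Low (zkey (pt P i))) (Low (zkey (pt P i.+1))).
  by rewrite -!lowP; try lia; apply: subgon_edge => //; lia.
have e2 : edge sf D (Low (zkey (pt P i.+1))) (Low (zkey (pt P i.+2))).
  by rewrite -!lowP; try lia; apply: subgon_edge.
have [_ h1] := IH i ltac:(lia) e1 (bj i ltac:(lia)).
have [h2 _] := IH i.+1 ltac:(lia) e2 (bj i.+1 ltac:(lia)).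
have lt1 : b < zkey (pt P i.+1).
  have := bj i ltac:(lia); have := lowedge_span H e1; lia.
have := hg lt1; set k := zkey (pt P i.+1) in h1 h2 *.
have ek : pt P i.+1 = Low k by rewrite -lowP //; lia.
have -> : corner_sum k = lam P + arc_sum k (zkey (pt P i)) k + arc_sum k k (zkey (pt P i.+2)).
  rewrite /corner_sum /arc_sum -ek -!lowP; try lia.
  rewrite (@big_condU _ _ _ _ (fun Q => (Q == P) || within (pt P i) (pt P i.+1) Q)
    (within (pt P i.+1) (pt P i.+2))).
  - rewrite (@big_condU _ _ _ _ (pred1 P) (within (pt P i) (pt P i.+1))) ?big_cond1 //.
    + exact: (gons_uniq H).
    + by apply/(gonsP H); rewrite -ek; split=> //; apply: mem_pt; lia.
    + move=> Q _; apply/negP => /andP[/eqP -> ].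
      by apply/negP; apply: (gap_neq H) => //; lia.
  - move=> Q /(gonsP H)[hQ]; rewrite -ek => kQ.
    by have [->|->|->] := gons_interior H hP hQ iP kQ; rewrite ?eqxx ?orbT.
  - move=> Q /(gonsP H)[hQ]; rewrite -ek => kQ; rewrite andb_orl negb_or.
    rewrite (within_disjoint H) // andbT; apply/negP => /andP[/eqP -> ].
    by apply/negP; apply: (gap_neq H).
move=> h3; rewrite -h1 -[X in X + _]h2; lra.
Qed.

(** Induction on the length of the arc, through the polygon directly below it: its gaps are shorter
    arcs, and the Chebyshev cycle carries the increment from its first gap to its base. *)
Lemma arc_increment x y : arc_ok x y.
Proof.
have [m] := ubnP (absz (y - x)%R); elim: m x y => // m IH x y mlt exy bx.
have /andP[xy yn] := lowedge_span H exy.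
case: (exy) => [s|d].
  have -> : y = x + 1 by move: s; case: (sf) => //= *; lia.
  have no k : arc_sum k x (x + 1) = 0.
    rewrite /arc_sum big1_seq // => P /andP[w /(gonsP H)[hP _]].
    by have := within_segment H x hP; rewrite w.
  by rewrite !no !mul0r !subr0 addrK.
have [P [hP e0 e1]] := inside_polygon H d.
have lo := low_between H e0 e1 hP; have sP := subgon_size hP.
have lowP j : (j < size P)%N -> pt P j = Low (zkey (pt P j)) by exact: (low_pt H).
have P0 : (0 < size P)%N by lia.
have P1 : ((size P).-1 < size P)%N by lia.
have IHP i : (i.+1 < size P)%N -> arc_ok (zkey (pt P i)) (zkey (pt P i.+1)).
  move=> iP; apply: IH; have iP' : (i < size P)%N by lia.
  have := pt_ltE hD hP P0 iP'; have := pt_ltE hD hP iP' P0.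
  have := pt_ltE hD hP iP P1; have := pt_ltE hD hP P1 iP; have := pt_ltE hD hP iP' iP.
  rewrite (lowP _ iP) (lowP _ iP') e0 e1 /blt /=; lia.
have rec := polygon_rec hP lo (_ : b <= zkey (pt P 0)) IHP.
rewrite e0 in rec; have {}rec := rec bx.
have := @cheb_cycle_first R (size P) sP (fun i => g (zkey (pt P i))) rec.
have := @cheb_cycle_last R (size P) (fun i => g (zkey (pt P i))) sP rec.
rewrite e0 e1 /= => c1 c0.
have ed i : (i.+1 < size P)%N -> edge sf D (Low (zkey (pt P i))) (Low (zkey (pt P i.+1))).
  by move=> iP; rewrite -!lowP; try lia; apply: subgon_edge.
have [hF _] := IHP 0%N ltac:(lia) (ed 0%N ltac:(lia)) ltac:(by rewrite e0).
have := IHP (size P - 2)%N ltac:(lia) (ed (size P - 2)%N ltac:(lia)).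
have -> : (size P - 2).+1 = (size P).-1 by lia.
have bl : b <= zkey (pt P (size P - 2)).
  have P2 : (size P - 2 < size P)%N by lia.
  have := pt_ltE hD hP P0 P2; rewrite e0 (lowP _ P2) /blt /=; lia.
move=> /(_ bl)[_ hL]; rewrite e0 e1 /= in hF hL.
have P2 : (size P - 2 < size P)%N by lia.
(* Below the arc, the polygons at [x] are [P] and those in its first gap; [S2] is the mirror image
   at [y]. *)
have S1 : arc_sum x x y = lam P + arc_sum x x (zkey (pt P 1)).
  rewrite /arc_sum -(lowP 1%N) ?(ltnW sP) //.
  rewrite (@big_condU _ _ _ _ (pred1 P) (within (Low x) (pt P 1))) ?big_cond1 //.
  - exact: (gons_uniq H).
  - by apply/(gonsP H); split=> //; rewrite -e0 mem_pt.
  - move=> Q /(gonsP H)[hQ xQ] /=; apply/idP/orP.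
      rewrite -e0 -e1 => w; rewrite -e0 in xQ.
      by case: (gons_first H hP hQ w xQ) => [->|]; [left|right].
    case=> [/eqP ->|]; first by have := subgon_within hD hP; rewrite e0 e1.
    apply: (within_trans H); rewrite -?e0 -?e1 ?(pt_ltE hD hP) //; try lia.
  - move=> Q _; apply/negP => /andP[/eqP -> ]; rewrite -e0.
    by apply/negP; apply: (gap_neq H) => //; lia.
have S2 : arc_sum y x y = lam P + arc_sum y (zkey (pt P (size P - 2))) y.
  rewrite /arc_sum -(lowP (size P - 2)%N) //.
  rewrite (@big_condU _ _ _ _ (pred1 P) (within (pt P (size P - 2)) (Low y))) ?big_cond1 //.
  - exact: (gons_uniq H).
  - by apply/(gonsP H); split=> //; rewrite -e1 mem_pt.
  - move=> Q /(gonsP H)[hQ xQ] /=; apply/idP/orP.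
      rewrite -e0 -e1 => w; rewrite -e1 in xQ.
      by case: (gons_last H hP hQ w xQ) => [->|]; [left|right].
    case=> [/eqP ->|]; first by have := subgon_within hD hP; rewrite e0 e1.
    apply: (within_trans H); rewrite -?e0 -?e1 ?(pt_ltE hD hP) //; try lia.
  - move=> Q _; apply/negP => /andP[/eqP -> ]; rewrite -e1.
    have := @gap_neq n sf D H P (size P - 2) hP; have -> : (size P - 2).+1 = (size P).-1 by lia.
    by move=> /(_ P1)/negP.
rewrite S1 S2; move: c0 c1 hF hL; lra.
Qed.

(** Chebyshev interpolation gives positivity at the vertices of the polygon below the arc, then
    induction treats its gaps. The left end may vanish, as it does where a continuant row starts. *)
Lemma arc_positive x y k : edge sf D (Low x) (Low y) -> b <= x ->
  0 <= g x -> 0 < g y -> x < k <= y -> 0 < g k.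
Proof.
have [m] := ubnP (absz (y - x)%R); elim: m x y => // m IH x y mlt exy bx gx gy xky.
have [->//|ky] := eqVneq k y.
have /andP[xy yn] := lowedge_span H exy.
case: (exy) => [s|d].
  by move: s; case: (sf) => //= *; lia.
have [P [hP e0 e1]] := inside_polygon H d.
have lo := low_between H e0 e1 hP; have sP := subgon_size hP.
have lowP j : (j < size P)%N -> pt P j = Low (zkey (pt P j)) by exact: (low_pt H).
have IHP i : (i.+1 < size P)%N -> arc_ok (zkey (pt P i)) (zkey (pt P i.+1)).
  by move=> _; apply: arc_increment.
have := @cheb_interp_gt0 R (size P) sP (fun i => g (zkey (pt P i)))
  (polygon_rec hP lo (_ : b <= zkey (pt P 0)) IHP).
rewrite e0 e1 /= => /(_ bx) pos.
have := @subgon_locate sf D hD P hP (Low k).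
rewrite e0 e1 => -[||/mem_ptP[i iP ei]|[i iP]]; first by case: (sf).
- by rewrite /between /blt /=; lia.
- have -> : k = zkey (pt P i) by rewrite ei.
  apply: pos => //; case: i iP ei => [|i] iP ei; last by lia.
  by move: ei xky; rewrite e0 => -[->]; rewrite ltxx.
have iP' : (i < size P)%N by lia.
rewrite {1}(lowP i iP') {1}(lowP i.+1 iP) /blt /= => kk.
have P0 : (0 < size P)%N by lia.
have P1 : ((size P).-1 < size P)%N by lia.
apply: (IH (zkey (pt P i)) (zkey (pt P i.+1))).
- have := pt_ltE hD hP P0 iP'; have := pt_ltE hD hP iP' P0.
  have := pt_ltE hD hP iP P1; have := pt_ltE hD hP P1 iP; have := pt_ltE hD hP iP' iP.
  rewrite (lowP _ iP) (lowP _ iP') e0 e1 /blt /=; lia.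
- by rewrite -!lowP; try lia; apply: subgon_edge.
- have := pt_ltE hD hP iP' P0; rewrite (lowP _ iP') e0 /blt /=; lia.
- case: i iP {iP' kk} => [|i] iP; first by rewrite e0.
  by apply/ltW/pos => //; lia.
- by apply: pos => //; lia.
- lia.
Qed.

(** The low polygons at [v] lie below one of the two adjacent steps; [arc_increment] removes them
    and replaces the neighbours of [v] by [u] and [w]. *)
Lemma bstep_rec u v w : bstep sf D u v -> bstep sf D v w -> b <= u ->
  g w + g u = bridging_sum v * g v.
Proof.
move=> s1 s2 bu; have lt1 := bstep_lt H s1; have lt2 := bstep_lt H s2.
have [_ h1] := arc_increment (bstep_edge H s1) bu.
have [h2 _] := arc_increment (bstep_edge H s2) (le_trans bu (ltW lt1)).
have bv : b < v by lia.
have := hg bv.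
have [bu' bv'] := bstep_bvertex H s1; have [_ bw'] := bstep_bvertex H s2.
have -> : corner_sum v = bridging_sum v + arc_sum v u v + arc_sum v v w.
  have inn := (within_low H).
  rewrite /corner_sum /arc_sum /bridging_sum.
  rewrite (@big_condU _ _ _ _ (fun Q => is_bridging Q || within (Low u) (Low v) Q)
    (within (Low v) (Low w))).
  - rewrite (@big_condU _ _ _ _ is_bridging (within (Low u) (Low v))) //.
    by move=> Q _; apply/negP => /andP[br /inn]; rewrite br.
  - move=> Q /(gonsP H)[hQ vQ]; have [//|lo] := boolP (is_bridging Q).
    by case/orP: (low_gon_at H s1 s2 hQ vQ lo) => ->; rewrite ?orbT.
  - move=> Q /(gonsP H)[hQ vQ]; rewrite andb_orl negb_or (within_disjoint H) // andbT.
    by apply/negP => /andP[br /inn]; rewrite br.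
move: h1 h2; lra.
Qed.

End OneSolution.

End Solutions.

(** * Continuants *)

Section Continuants.
Variables (R : comPzRingType) (c : nat -> R).

(* The value at [a + t] of the solution that is [0] at [a] and [1] at [a + 1]. *)
Fixpoint contin (a t : nat) {struct t} : R :=
  if t is t'.+1 then
    if t' is t''.+1 then c a.+1 * contin a.+1 t' - contin a.+2 t'' else 1
  else 0.

Lemma continSS a t : contin a t.+2 = c a.+1 * contin a.+1 t.+1 - contin a.+2 t.
Proof. by []. Qed.

(** The definition expands a continuant at its left end; this is the expansion at the right end. *)
Lemma contin_recr a t :
  contin a t.+2 + contin a t = c (a + t.+1)%N * contin a t.+1.
Proof.
suff : contin a t.+2 + contin a t = c (a + t.+1)%N * contin a t.+1 /\
  contin a t.+3 + contin a t.+1 = c (a + t.+2)%N * contin a t.+2 by case.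
elim: t a => [|t IH] a.
  by rewrite addn1 addn2; split=> /=; ring.
have [IH1 IH2] := IH a; split=> //.
have [h1 h2] := IH a.+1; have [h3 _] := IH a.+2.
rewrite (continSS a t.+2) (continSS a t) (continSS a t.+1).
have -> : (a + t.+3 = a.+1 + t.+2)%N by rewrite addSnnS.
have -> : c (a.+1 + t.+2)%N * (c a.+1 * contin a.+1 t.+2 - contin a.+2 t.+1) =
  c a.+1 * (contin a.+1 t.+3 + contin a.+1 t.+1) - (contin a.+2 t.+2 + contin a.+2 t).
  by rewrite h2 h3 (_ : (a.+2 + t.+1 = a.+1 + t.+2)%N) ?addSnnS //; ring.
ring.
Qed.

Lemma contin_det a t :
  contin a t.+1 * contin a.+1 t.+1 - contin a t.+2 * contin a.+1 t = 1.
Proof.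
elim: t a => [|t IH] a; first by rewrite /=; ring.
by rewrite -(IH a.+1) (continSS a t.+1) (continSS a t); ring.
Qed.

Lemma contin_per n : (forall k, c (k + n)%N = c k) ->
  forall a t, contin (a + n) t = contin a t.
Proof.
move=> cper a t.
suff : contin (a + n) t = contin a t /\ contin (a + n) t.+1 = contin a t.+1 by case.
elim: t a => [|t IH] a //; have [h1 h2] := IH a; split=> //.
by rewrite !continSS -!addSn cper (IH a.+1).2 (IH a.+2).1.
Qed.

Variable h : nat -> R.
Hypothesis hrec : forall k, h k.+2 + h k = c k.+1 * h k.+1.

Lemma contin_sol a t :
  h (a + t.+1)%N = contin a t.+1 * h a.+1 - contin a.+1 t * h a.
Proof.
elim: t a => [|t IH] a; first by rewrite addn1 /=; ring.
have -> : (a + t.+2 = a.+1 + t.+1)%N by rewrite addSnnS.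
rewrite IH continSS; have -> : h a.+2 = c a.+1 * h a.+1 - h a by rewrite -hrec addrK.
ring.
Qed.

Variable n : nat.
Hypothesis n_gt0 : (0 < n)%N.
Hypothesis cper : forall k, c (k + n)%N = c k.

(** Cayley-Hamilton for the monodromy over one period: [contin_det] gives determinant 1, and the
    coefficient is the trace in the basis of [contin_sol]. Both sides solve the recurrence, so two
    consecutive indices suffice. *)
Lemma contin_cayley k :
  h (k + n + n)%N + h k = (contin 0 n.+1 - contin 1 n.-1) * h (k + n)%N.
Proof.
set s := (_ - _).
suff : h (k + n + n)%N + h k = s * h (k + n)%N /\
  h (k.+1 + n + n)%N + h k.+1 = s * h (k.+1 + n)%N by case.
elim: k => [|k [IH1 IH2]].
  case: (n) n_gt0 cper @s => // m _ cper' s.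
  have e1 := contin_sol 0 m; have e2 := contin_sol 0 m.+1.
  have e3 := contin_sol m.+1 m; have e4 := contin_sol m.+1 m.+1.
  have per := contin_per cper'.
  rewrite -[X in contin X](add0n m.+1) -[X in contin X.+1](add0n m.+1) -addSn !per in e3 e4.
  have det := contin_det 0 m.
  rewrite !add0n in e1 e2 e3 e4 *.
  have -> : (1 + m.+1 = m.+2)%N by rewrite addnC addn1.
  have -> : (m.+2 + m.+1 = m.+1 + m.+2)%N by rewrite addnC.
  rewrite e3 e4 e1 e2 /s [m.+1.-1]/=.
  (* The coefficient 1 of the last summand is expanded into the determinant, after which both claims
     are polynomial identities. *)
  by split; rewrite -[X in _ + X]mul1r -det; ring.
split=> //.
have h1 := hrec (k + n + n); have h2 := hrec k; have h3 := hrec (k + n)%N.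
rewrite -!addSn !cper in h1 h3.
have -> : h (k.+2 + n + n)%N = c k.+1 * h (k.+1 + n + n)%N - h (k + n + n)%N by rewrite -h1 addrK.
have -> : h k.+2 = c k.+1 * h k.+1 - h k by rewrite -h2 addrK.
have -> : h (k.+2 + n)%N = c k.+1 * h (k.+1 + n)%N - h (k + n)%N by rewrite -h3 addrK.
have -> : c k.+1 * h (k.+1 + n + n)%N - h (k + n + n)%N + (c k.+1 * h k.+1 - h k) =
  c k.+1 * (h (k.+1 + n + n)%N + h k.+1) - (h (k + n + n)%N + h k) by ring.
by rewrite IH1 IH2; ring.
Qed.

End Continuants.

Lemma contin_shift (R : comPzRingType) (c c' : nat -> R) d a t :
  (forall k, c' k = c (k + d)%N) -> contin c' a t = contin c (a + d) t.
Proof.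
move=> cc; suff : contin c' a t = contin c (a + d) t /\
  contin c' a t.+1 = contin c (a + d) t.+1 by case.
elim: t a => [|t IH] a //; have [h1 h2] := IH a; split=> //.
by rewrite !continSS cc (IH a.+1).2 (IH a.+2).1.
Qed.

(** If one continuant vanished, [contin_det] would exhibit 1 as minus a product of nonnegative
    numbers. *)
Lemma contin_gt0 (R : realType) (c : nat -> R) :
  (forall a t, 0 <= contin c a t) -> forall a t, 0 < contin c a t.+1.
Proof.
move=> ge0 a t; rewrite lt_neqAle ge0 andbT; apply/eqP => e.
have := contin_det c a t; rewrite -e mul0r sub0r => det.
have := mulr_ge0 (ge0 a t.+2) (ge0 a.+1 t); lra.
Qed.

(** * Choice sums with multiplicative weights *)

Lemma big_choices_cons (R : nmodType) (T : Type) (L : seq T) Ls (f : seq T -> R) :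
  \sum_(s <- choices (L :: Ls)) f s = \sum_(x <- L) \sum_(s <- choices Ls) f (x :: s).
Proof. by rewrite /= big_allpairs_dep. Qed.

Lemma big_choices_rcons (R : nmodType) (T : eqType) (L : seq T) Ls (f : seq T -> R) :
  (forall s s', perm_eq s s' -> f s = f s') ->
  \sum_(s <- choices (rcons Ls L)) f s = \sum_(s <- choices (L :: Ls)) f s.
Proof.
elim: Ls f => [|L' Ls IH] f fperm //.
rewrite rcons_cons !big_choices_cons.
transitivity (\sum_(x' <- L') \sum_(x <- L) \sum_(s <- choices Ls) f (x' :: x :: s)).
  apply: eq_bigr => x' _; rewrite IH ?big_choices_cons // => s s' ss'.
  by apply: fperm; rewrite perm_cons.
rewrite exchange_big; apply: eq_bigr => x _; rewrite big_choices_cons.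
apply: eq_bigr => x' _; apply: eq_bigr => s _; apply: fperm.
by rewrite -[x' :: x :: s]/([:: x'] ++ [:: x] ++ s) perm_catCA.
Qed.

Section Weights.
Variables (R : comPzRingType) (T : eqType) (W : T -> nat -> R).
Hypothesis W0 : forall x, W x 0 = 1.

Definition weight (s : seq T) : R := \prod_(x <- undup s) W x (count_mem x s).

Definition cofactor (x : T) (s : seq T) : R :=
  \prod_(y <- undup s | y != x) W y (count_mem y s).

Let weight_cond (A : pred T) (E s : seq T) : uniq E -> {subset s <= E} ->
  \prod_(x <- undup s | A x) W x (count_mem x s) = \prod_(x <- E | A x) W x (count_mem x s).
Proof.
move=> uE sE; rewrite [RHS](bigID (mem s)) /= [X in _ * X]big1 ?mulr1; last first.
  by move=> x /andP[_ xs]; rewrite (count_memPn xs).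
rewrite -[RHS]big_filter -[LHS]big_filter; apply: perm_big; apply: uniq_perm.
- by rewrite filter_uniq // undup_uniq.
- exact: filter_uniq.
- move=> x; rewrite !mem_filter mem_undup -andbA; congr (_ && _).
  by have [/sE ->|] := boolP (x \in s).
Qed.

Lemma weight_ext (E s : seq T) : uniq E -> {subset s <= E} ->
  weight s = \prod_(x <- E) W x (count_mem x s).
Proof. exact: weight_cond. Qed.

Lemma weight_perm s s' : perm_eq s s' -> weight s = weight s'.
Proof.
move=> ss'; rewrite [RHS](weight_ext (undup_uniq s)) => [|x].
  by apply: eq_bigr => x _; rewrite (permP ss').
by rewrite mem_undup (perm_mem ss').
Qed.

Lemma cofactor_perm x s s' : perm_eq s s' -> cofactor x s = cofactor x s'.
Proof.
move=> ss'; rewrite [RHS](weight_cond _ (undup_uniq s)) => [|y].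
  by apply: eq_bigr => y _; rewrite (permP ss').
by rewrite mem_undup (perm_mem ss').
Qed.

Lemma weight_cofactor x s : weight s = W x (count_mem x s) * cofactor x s.
Proof.
pose E := undup (x :: s).
have sE : {subset s <= E} by move=> y ys; rewrite mem_undup inE ys orbT.
rewrite (weight_ext (undup_uniq _) sE) /cofactor (weight_cond _ (undup_uniq _) sE).
by rewrite (bigD1_seq x) ?undup_uniq // mem_undup inE eqxx.
Qed.

Lemma cofactor_cons x s : cofactor x (x :: s) = cofactor x s.
Proof.
pose E := undup (x :: s).
have sE : {subset s <= E} by move=> y ys; rewrite mem_undup inE ys orbT.
have sE' : {subset x :: s <= E} by move=> y ys; rewrite mem_undup.
rewrite /cofactor (weight_cond _ (undup_uniq _) sE) (weight_cond _ (undup_uniq _) sE').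
by apply: eq_bigr => y nyx /=; rewrite eq_sym (negbTE nyx).
Qed.

End Weights.

(** * Chebyshev weights without truncation, and their three-term recurrence *)

Section NaturalWeights.
Variables (R : realType) (T : eqType) (lam : T -> R).

Definition natw (x : T) (k : nat) : R := chebU k (lam x).

Definition natsum (Ls : seq (seq T)) : R := \sum_(s <- choices Ls) weight natw s.

Definition chebU_pred (k : nat) (x : R) : R := if k is k'.+1 then chebU k' x else 0.

(** The term U_(k-1) of U_(k+1) = x U_k - U_(k-1), times the factors of all elements other than
    [x]. *)
Definition defect (x : T) (s : seq T) : R :=
  chebU_pred (count_mem x s) (lam x) * cofactor natw x s.

Let natw0 x : natw x 0 = 1. Proof. by []. Qed.

Lemma weight_cons x s : weight natw (x :: s) = lam x * weight natw s - defect x s.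
Proof.
rewrite !(weight_cofactor natw0 x) cofactor_cons // /defect /= eqxx add1n.
rewrite /natw; case: (count_mem x s) => [|k] /=; ring.
Qed.

Lemma defect_perm x s s' : perm_eq s s' -> defect x s = defect x s'.
Proof. by move=> ss'; rewrite /defect (permP ss') (cofactor_perm natw0 x ss'). Qed.

Lemma defect_notin x s : x \notin s -> defect x s = 0.
Proof. by move=> xs; rewrite /defect (count_memPn xs) mul0r. Qed.

Lemma mem_choice_flatten (Ls : seq (seq T)) s x :
  s \in choices Ls -> x \in s -> x \in flatten Ls.
Proof.
rewrite mem_choices; elim: Ls s => [|L Ls IH] [|y s] //= /andP[yL sL].
by rewrite inE mem_cat => /orP[/eqP ->|/(IH _ sL) ->]; rewrite ?yL ?orbT.
Qed.

(** A nonzero defect requires [x] to occur. If [x] is taken from [L], the shifted index restores the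
    weight of the remaining choices; any other first choice would need [x] later, which the
    hypothesis excludes. *)
Lemma defect_sum x L Ls : uniq L -> x \in L ->
  (x \in flatten Ls -> forall y, y \in L -> y = x) ->
  \sum_(s <- choices (L :: Ls)) defect x s = natsum Ls.
Proof.
move=> uL xL hx; rewrite big_choices_cons (bigD1_seq x) //= [X in _ + X]big_seq_cond.
rewrite [X in _ + X]big1 ?addr0 => [|y /andP[yL nyx]].
  apply: eq_bigr => s _; rewrite /defect /= eqxx add1n /= cofactor_cons //.
  by rewrite (weight_cofactor natw0 x).
rewrite big_seq big1 // => s sLs; apply: defect_notin.
rewrite inE negb_or eq_sym nyx; apply/negP => xs.
by move: nyx; rewrite (hx (mem_choice_flatten sLs xs) y yL) eqxx.
Qed.

Lemma sum_weight_cons x Ls : \sum_(s <- choices Ls) weight natw (x :: s) =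
  lam x * natsum Ls - \sum_(s <- choices Ls) defect x s.
Proof.
by rewrite /natsum mulr_sumr -sumrB; apply: eq_bigr => s _; rewrite weight_cons.
Qed.

Lemma defect_sum0 x Ls : x \notin flatten Ls -> \sum_(s <- choices Ls) defect x s = 0.
Proof.
move=> xL; rewrite big_seq big1 // => s sL; apply: defect_notin.
by apply: contra xL => /(mem_choice_flatten sL).
Qed.

Lemma natsum_nil : natsum [::] = 1.
Proof. by rewrite /natsum /= big_seq1 /weight big_nil. Qed.

Lemma natsum_cons L Ls : natsum (L :: Ls) = (\sum_(x <- L) lam x) * natsum Ls -
  \sum_(x <- L) \sum_(s <- choices Ls) defect x s.
Proof.
rewrite {1}/natsum big_choices_cons mulr_suml -sumrB.
by apply: eq_bigr => x _; rewrite sum_weight_cons.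
Qed.

Lemma natsum1 L : natsum [:: L] = \sum_(x <- L) lam x.
Proof.
rewrite natsum_cons natsum_nil mulr1 [X in _ - X]big1 ?subr0 // => x _.
by rewrite defect_sum0.
Qed.

(** Of the elements of [L] only [x] can be chosen again, so a single defect survives, and by
    [defect_sum] it is the sum over [Ls]. This is the recursion that defines [contin]. *)
Lemma natsum_step L L' Ls x : uniq L -> uniq L' -> x \in L -> x \in L' ->
  (forall y, y \in L -> y != x -> y \notin L' ++ flatten Ls) ->
  (x \in flatten Ls -> forall y, y \in L' -> y = x) ->
  natsum (L :: L' :: Ls) = (\sum_(y <- L) lam y) * natsum (L' :: Ls) - natsum Ls.
Proof.
move=> uL uL' xL xL' h1 h2; rewrite natsum_cons; congr (_ - _).
rewrite (bigD1_seq x) //= defect_sum // big_seq_cond big1 ?addr0 // => y /andP[yL nyx].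
by apply: (@defect_sum0 y (L' :: Ls)); apply: h1.
Qed.

End NaturalWeights.

(** * The skeleton of bridging polygons *)

Section Chain.
Variables (n : nat) (sf : surface) (D : set (mpoint * mpoint)).
Hypothesis H : strip_dissection n sf D.
#[local] Set Default Proof Using "All".
Let hD := strip_dissected H.
Notation gons := (gons sf D).

Definition bgons (k : int) : seq (seq mpoint) := [seq P <- gons k | is_bridging P].

Lemma bgonsP k P :
  reflect [/\ subgon sf D P, Low k \in P & is_bridging P] (P \in bgons k).
Proof.
rewrite mem_filter; apply: (iffP andP) => [[br /(gonsP H)[]]|[hP kP br]] //.
by split=> //; apply/(gonsP H).
Qed.

Lemma bgons_uniq k : uniq (bgons k).
Proof. by rewrite filter_uniq // (gons_uniq H). Qed.

Lemma gons_deck k t :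
  perm_eq (gons (k + t * n%:Z)) [seq map (deck sf t) P | P <- gons k].
Proof.
apply: uniq_perm; first exact: (gons_uniq H).
  rewrite map_inj_uniq ?(gons_uniq H) //; apply: inj_map; exact: deck_inj.
move=> P; apply/(gonsP H)/mapP => [[hP kP]|[Q /(gonsP H)[hQ kQ] ->]].
  exists (map (deck sf (- t)) P); last by rewrite map_deckD subrr map_deck0.
  apply/(gonsP H); split; first exact: (subgon_deck hD).
  by rewrite (mem_deck H) mulNr opprK.
by split; [exact: (subgon_deck hD)|rewrite (mem_deck H) addrK].
Qed.

Lemma bgons_deck k t :
  perm_eq (bgons (k + t * n%:Z)) [seq map (deck sf t) P | P <- bgons k].
Proof.
rewrite /bgons; have := perm_filter is_bridging (gons_deck k t).
move=> /permPl ->; rewrite filter_map.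
rewrite (@eq_filter _ (preim _ _) is_bridging) // => P /=; exact: bridging_deck.
Qed.

Lemma blt_low z k : blt z (Low k) -> exists i, z = Low i.
Proof. by case: z => [i|i|] //; exists i. Qed.

(** Low vertices precede inner ones in a polygon, so the vertex after [k] is low when a later low
    vertex exists; the edge to it is then the unique step out of [k]. *)
Lemma bgon_next P k l w : subgon sf D P -> is_bridging P -> Low k \in P ->
  Low l \in P -> k < l -> bstep sf D k w ->
  exists2 i, (i.+1 < size P)%N & pt P i = Low k /\ pt P i.+1 = Low w.
Proof.
move=> hP br /mem_ptP[i iP ei] /mem_ptP[j jP ej] kl st.
have ij : (i < j)%N by rewrite -(pt_ltE hD hP) // ei ej /blt /=; lia.
have iP1 : (i.+1 < size P)%N by lia.
have [w' ew] : exists w', pt P i.+1 = Low w'.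
  have [e|ne] := eqVneq i.+1 j; first by exists l; rewrite e.
  by apply: (@blt_low _ l); rewrite -ej (pt_ltE hD hP) //; lia.
exists i => //; rewrite ei ew; split=> //; congr Low.
apply: (bstep_uniqr H) st; exists P; split=> //; exists i => //.
Qed.

Lemma bgon_prev P k l w : subgon sf D P -> is_bridging P -> Low k \in P ->
  Low l \in P -> k < l -> bstep sf D w l -> Low w \in P.
Proof.
move=> hP br /mem_ptP[i iP ei] /mem_ptP[j jP ej] kl st.
have ij : (i < j)%N by rewrite -(pt_ltE hD hP) // ei ej /blt /=; lia.
have jP1 : (j.-1 < size P)%N by lia.
have [w' ew] : exists w', pt P j.-1 = Low w'.
  by apply: (@blt_low _ l); rewrite -ej (pt_ltE hD hP) //; lia.
suff -> : w = w' by rewrite -ew mem_pt.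
apply: (bstep_uniql H st); exists P; split=> //; exists j.-1; rewrite prednK //; lia.
Qed.

Lemma bgon_edge_uniq P Q v w : subgon sf D P -> is_bridging P ->
  subgon sf D Q -> is_bridging Q -> bstep sf D v w ->
  Low v \in P -> Low w \in P -> Low v \in Q -> Low w \in Q -> Q = P.
Proof.
move=> hP brP hQ brQ st vP wP vQ wQ; apply: contrapT => neq.
have vw := bstep_lt H st.
have [i iP [ei ej]] := bgon_next hP brP vP wP vw st.
have iP' : (i < size P)%N by lia.
have [|[k kP w']|/withoutP/(_ _ wQ)] := @nest sf D hD P Q hP hQ; first by move=> e; apply: neq.
  have e1 : k = i.
    have := within_gap H hP hQ kP w' iP; have := within_gap H hP hQ kP w' iP'.
    by rewrite ei ej => /(_ vQ) ? /(_ wQ); lia.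
  by move: w'; rewrite e1 ei ej => /(within_low H); rewrite brQ.
have sP := subgon_size hP; have P1 : ((size P).-1 < size P)%N by lia.
have P0 : (0 < size P)%N by lia.
rewrite -ej (pt_ltE hD hP) // (pt_ltE hD hP) // => h.
(* Then [Low w] is the last vertex of [P], which leaves no place for an inner one. *)
have e : i.+1 = (size P).-1 by lia.
move: brP => /hasP[z /mem_ptP[k kP ek] iz].
have := pt_ltE hD hP iP kP; rewrite ej ek; move: iz; clear -e kP.
by case: z => //=; rewrite /blt /=; lia.
Qed.

(** Here [v] is an interior vertex of [P] between two steps; any other polygon at [v] lies below one
    of them and is low. *)
Lemma bgon_middle P Q u v w : subgon sf D P -> is_bridging P ->
  subgon sf D Q -> is_bridging Q -> bstep sf D u v -> bstep sf D v w ->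
  Low u \in P -> Low w \in P -> Low v \in Q -> Q = P.
Proof.
move=> hP brP hQ brQ s1 s2 uP wP vQ.
have lt1 := bstep_lt H s1; have lt2 := bstep_lt H s2.
have [i iP [ei ej]] := bgon_next hP brP uP wP (lt_trans lt1 lt2) s1.
have vP : Low v \in P by rewrite -ej mem_pt.
have [j jP [ej' ek]] := bgon_next hP brP vP wP lt2 s2.
have ji : j = i.+1.
  by apply: (pt_inj hD hP) => //; [lia|rewrite ej' ej].
rewrite ji in jP ek; rewrite -ej in vQ.
have [//||] := gons_interior H hP hQ jP vQ; rewrite ?ei ?ej ?ek => /(within_low H);
  by rewrite brQ.
Qed.

Definition nextv (v : int) : int := xget v [set w | bstep sf D v w].
Definition chain (v : int) (t : nat) : int := iter t nextv v.

Lemma nextvP v : bvertex sf D v -> bstep sf D v (nextv v).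
Proof.
by move=> /(bstep_next H)[w st]; rewrite /nextv; case: xgetP => [x _ //|/(_ w)].
Qed.

Section FromVertex.
Variable v0 : int.
Hypothesis bv0 : bvertex sf D v0.

Lemma chain_bvertex t : bvertex sf D (chain v0 t).
Proof. by elim: t => //= t /nextvP/(bstep_bvertex H)[]. Qed.

Lemma chain_step t : bstep sf D (chain v0 t) (chain v0 t.+1).
Proof. exact: nextvP (chain_bvertex t). Qed.

Lemma chain_lt i j : (i < j)%N -> chain v0 i < chain v0 j.
Proof.
elim: j => // j IH; rewrite ltnS leq_eqVlt => /orP[/eqP ->|/IH lt].
  exact: (bstep_lt H (chain_step j)).
exact: lt_trans lt (bstep_lt H (chain_step j)).
Qed.

Lemma chain_ltE i j : (chain v0 i < chain v0 j) = (i < j)%N.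
Proof.
have [/chain_lt ->//|/chain_lt|->] := ltngtP i j; last by rewrite ltxx.
by move=> h; apply/negbTE; rewrite -leNgt ltW.
Qed.

Lemma chain_inj : injective (chain v0).
Proof.
move=> i j e; have := chain_ltE i j; have := chain_ltE j i.
by rewrite e ltxx; lia.
Qed.

Lemma chain_ge t : v0 + t%:Z <= chain v0 t.
Proof.
elim: t => [|t IH]; first by rewrite addr0.
have := bstep_lt H (chain_step t); rewrite -addn1 PoszD addrA /=; lia.
Qed.

Lemma chain_locate k : v0 <= k -> exists t, chain v0 t <= k < chain v0 t.+1.
Proof.
move=> vk; have ex : exists t, k < chain v0 t.
  by exists (absz (k - v0)%R).+1; have := chain_ge (absz (k - v0)%R).+1; lia.
case: (ex_minnP ex) => -[|t] kt min; first by move: kt => /=; lia.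
exists t; rewrite kt andbT leNgt; apply/negP => /min; lia.
Qed.

Lemma chain_onto k : v0 <= k -> bvertex sf D k -> exists t, chain v0 t = k.
Proof.
move=> vk bk; have [t /andP[h1 h2]] := chain_locate vk; exists t.
apply/eqP; rewrite eq_le h1 /= leNgt; apply/negP => h.
by have := bstep_gap H (chain_step t) h bk; rewrite leNgt h2.
Qed.

Definition chain_gons (a t : nat) : seq (seq (seq mpoint)) :=
  [seq bgons (chain v0 k) | k <- iota a t].

Lemma mem_chain_gons P a t : P \in flatten (chain_gons a t) ->
  exists k, [/\ (a <= k < a + t)%N, subgon sf D P, is_bridging P & Low (chain v0 k) \in P].
Proof.
move=> /flattenP[L /mapP[k]]; rewrite mem_iota => kt -> /bgonsP[hP kP br].
by exists k.
Qed.

End FromVertex.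

Lemma count_choice (T : eqType) (L : int -> seq T) ks s x :
  s \in choices [seq L k | k <- ks] -> (count_mem x s <= count (fun k => x \in L k) ks)%N.
Proof.
rewrite mem_choices; elim: ks s => [|k ks IH] [|y s] //= /andP[yL /IH le].
by apply: leq_add => //; case: eqVneq => // e; rewrite -e yL.
Qed.

(** Different positions use different low vertices of [P], and at least one vertex of [P] is
    inner. *)
Lemma count_bgon ks s P : uniq ks -> s \in choices [seq bgons k | k <- ks] ->
  P \in s -> (count_mem P s < size P)%N.
Proof.
move=> uks sk Ps; have := mem_choice_flatten sk Ps.
move=> /flattenP[L /mapP[k0 _ ->] /bgonsP[hP _ br]].
apply: leq_ltn_trans (count_choice P sk) _.
rewrite -size_filter -(size_map Low).
apply: (@leq_ltn_trans (size [seq z <- P | ~~ inner z])).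
  apply: uniq_leq_size.
    by rewrite map_inj_uniq ?filter_uniq // => x y [].
  move=> z /mapP[k]; rewrite mem_filter => /andP[/bgonsP[_ kP _] _] ->.
  by rewrite mem_filter.
rewrite size_filter -(count_predC inner P) -[ltnLHS]add0n ltn_add2r.
by rewrite -has_count.
Qed.

End Chain.

(** * Continuants as sums over choices of bridging polygons *)

Section Growth.
Variables (R : realType) (n : nat) (sf : surface) (D : set (mpoint * mpoint)).
Hypothesis H : strip_dissection n sf D.
#[local] Set Default Proof Using "All".
Let hD := strip_dissected H.
Notation gons := (gons sf D).
Notation bgons := (bgons sf D).
Notation chain := (chain sf D).
Notation lam := (fun P : seq mpoint => lambda R (size P)).

Lemma bridging_sumE k : bridging_sum R sf D k = \sum_(P <- bgons k) lam P.
Proof. by rewrite /bgons big_filter. Qed.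

Lemma bridging_sum_deck k t : bridging_sum R sf D (k + t * n%:Z) = bridging_sum R sf D k.
Proof.
rewrite !bridging_sumE (perm_big _ (bgons_deck H k t)) big_map.
by apply: eq_bigr => P _; rewrite size_map.
Qed.

Definition chain_sum (v0 : int) (t : nat) : R := bridging_sum R sf D (chain v0 t).

(** The repeatable element required by [natsum_step] is the bridging polygon on the step between the
    first two vertices. *)
Lemma natsum_chain v0 a t : bvertex sf D v0 ->
  natsum lam (chain_gons sf D v0 a.+1 t) = contin (chain_sum v0) a t.+1.
Proof.
move=> bv0.
suff : natsum lam (chain_gons sf D v0 a.+1 t) = contin (chain_sum v0) a t.+1 /\
  natsum lam (chain_gons sf D v0 a.+1 t.+1) = contin (chain_sum v0) a t.+2 by case.
elim: t a => [|t IH] a.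
  by rewrite natsum_nil natsum1 /= /chain_sum bridging_sumE; split=> //; rewrite mulr1 subr0.
split; first by case: (IH a).
have [x [hx brx [i iP [ei ej]]]] := chain_step H bv0 a.+1.
have xv : Low (chain v0 a.+1) \in x by rewrite -ei mem_pt //; lia.
have xw : Low (chain v0 a.+2) \in x by rewrite -ej mem_pt.
rewrite continSS -(IH a.+1).2 -(IH a.+2).1 /chain_sum bridging_sumE.
rewrite {1}/chain_gons [iota _ _]/= !map_cons.
rewrite (@natsum_step _ _ lam _ _ _ x) //; try exact: (bgons_uniq H).
- by apply/(bgonsP H).
- by apply/(bgonsP H).
(* A polygon at the first vertex that occurs later contains the first step, and only [x] does. *)
- move=> y /(bgonsP H)[hy vy bry] nyx; apply: contra nyx; rewrite mem_cat.
  have st := chain_step H bv0 a.+1.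
  move=> yw; apply/eqP; suff wy : Low (chain v0 a.+2) \in y.
    exact: (bgon_edge_uniq H hx brx hy bry st xv xw vy wy).
  case/orP: yw => [/(bgonsP H)[]//|/(mem_chain_gons H bv0)[k [kt _ _ ky]]].
  have lt : chain v0 a.+1 < chain v0 k by rewrite (chain_ltE H bv0); lia.
  by have [j jP [_ <-]] := bgon_next H hy bry vy ky lt st; rewrite mem_pt.
(* If [x] reaches beyond the second vertex, it is the only bridging polygon there. *)
- move=> /(mem_chain_gons H bv0)[k [kt _ _ kx]] y /(bgonsP H)[hy wy bry].
  have lt : chain v0 a.+2 < chain v0 k by rewrite (chain_ltE H bv0); lia.
  have [j jP [_ ew]] := bgon_next H hx brx xw kx lt (chain_step H bv0 a.+2).
  have xw' : Low (chain v0 a.+3) \in x by rewrite -ew mem_pt.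
  exact: (bgon_middle H hx brx hy bry (chain_step H bv0 _) (chain_step H bv0 _) xv xw' wy).
Qed.

Lemma natsum_bgons_ge0 ks : uniq ks -> 0 <= natsum lam [seq bgons k | k <- ks].
Proof.
move=> uks; rewrite /natsum big_seq sumr_ge0 // => s sk.
rewrite /weight big_seq prodr_ge0 // => P; rewrite mem_undup => Ps.
have := count_bgon H uks sk Ps.
have := mem_choice_flatten sk Ps => /flattenP[L /mapP[k0 _ ->] /(bgonsP H)[hP _ br]].
by move=> ?; apply: chebU_lambda_ge0 => //; apply: (subgon_size hP).
Qed.

Lemma contin_chain_gt0 v0 a t : bvertex sf D v0 -> 0 < contin (chain_sum v0) a t.+1.
Proof.
move=> bv0; apply: contin_gt0 => {t} b [//|t]; rewrite -natsum_chain //.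
have -> : chain_gons sf D v0 b.+1 t = [seq bgons k | k <- [seq chain v0 k | k <- iota b.+1 t]].
  by rewrite -map_comp.
apply: natsum_bgons_ge0; rewrite map_inj_uniq ?iota_uniq //.
exact: (chain_inj H bv0).
Qed.

(** * Positivity and the growth coefficient *)

Definition corner_row (i : int) (k : nat) : R := corner_sum R sf D (i + k%:Z).

Lemma contin_solution b :
  solution sf D b (fun k => contin (corner_row b) 0 (absz (k - b)%R)).
Proof.
move=> k bk; have [t et] : exists t : nat, k = b + t.+1%:Z.
  by exists (absz (k - b - 1)%R); lia.
have -> : absz (k + 1 - b)%R = t.+2 by lia.
have -> : absz (k - 1 - b)%R = t by lia.
have -> : absz (k - b)%R = t.+1 by lia.
by rewrite contin_recr add0n /corner_row et.
Qed.

Lemma contin_corner_gt0_base v0 t : bvertex sf D v0 ->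
  0 < contin (corner_row v0) 0 t.+1.
Proof.
move=> bv0; pose g k := contin (corner_row v0) 0 (absz (k - v0)%R).
have hg : solution sf D v0 g by exact: contin_solution.
have g0 : g v0 = 0 by rewrite /g subrr.
have g1 : g (v0 + 1) = 1 by rewrite /g (_ : absz (v0 + 1 - v0)%R = 1%N) //; lia.
have st k := chain_step H bv0 k.
have le k : v0 <= chain v0 k by have := chain_ge H bv0 k; lia.
(* As [g] vanishes at [v0], the increment along the first step carries the value 1 at [v0 + 1] to
   the next bridging vertex; from there [g] follows the continuants of the reduced recurrence. *)
have gv1 : g (chain v0 1) = 1.
  have [<- _] := arc_increment H hg (bstep_edge H (st 0%N)) (lexx _).
  by rewrite /= g0 g1 mulr0 subr0.
have hrec k : g (chain v0 k.+2) + g (chain v0 k) = chain_sum v0 k.+1 * g (chain v0 k.+1).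
  exact: (bstep_rec H hg (st k) (st k.+1) (le k)).
have pos k : 0 < g (chain v0 k.+1).
  have := contin_sol hrec 0 k; rewrite add0n /= -/(chain v0 1) gv1 g0 mulr0 subr0 mulr1 => ->.
  exact: contin_chain_gt0.
have ge k : 0 <= g (chain v0 k) by case: k => [|k]; [rewrite g0|apply: ltW].
have -> : contin (corner_row v0) 0 t.+1 = g (v0 + t.+1%:Z).
  by rewrite /g; have -> : absz (v0 + t.+1%:Z - v0)%R = t.+1 by lia.
have [k hk] := @chain_locate n sf D H v0 bv0 (v0 + t.+1%:Z - 1) ltac:(lia).
apply: (arc_positive H hg (bstep_edge H (st k)) (le k) (ge k) (pos k)); lia.
Qed.

(** The row started at a bridging vertex strictly to the left of [i] is a solution positive at [i]
    and beyond. By [contin_sol] such a solution forces positive continuants, by induction on their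
    length. *)
Lemma contin_corner_gt0 i t : 0 < contin (corner_row i) 0 t.+1.
Proof.
have [v [z bb]] := bbase_exists H.
have [v0 [z0 [/(bbase_bvertex H) bv0 v0i]]] := bbase_shift H (i - 1) bb.
pose h k := contin (corner_row v0) 0 k.
have hrec k : h k.+2 + h k = corner_row v0 k.+1 * h k.+1 by rewrite /h contin_recr.
have hpos k : 0 < h k.+1 by exact: contin_corner_gt0_base.
have [d ed] : exists d : nat, i = v0 + d.+1%:Z by exists (absz (i - v0 - 1)%R); lia.
rewrite (@contin_shift _ (corner_row v0) _ d.+1) ?add0n; last first.
  by move=> k; rewrite /corner_row ed -addrA -PoszD addnC.
elim: t d {ed} => // t IH d.
rewrite -(pmulr_lgt0 _ (hpos d.+1)).
have := contin_sol hrec d.+1 t.+1 => e.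
have -> : contin (corner_row v0) d.+1 t.+2 * h d.+2 =
  h (d.+1 + t.+2)%N + contin (corner_row v0) d.+2 t.+1 * h d.+1 by rewrite e subrK.
by rewrite addSn addr_gt0 // mulr_gt0.
Qed.

Variable F : int -> int -> R.
Hypothesis hF : frieze_pattern F.
Hypothesis hper : periodic_quiddity n F.
Hypothesis hreal : realizes sf D F.

Lemma quiddity_corner i : quiddity F i = corner_sum R sf D i.
Proof. by rewrite hreal (big_gons H). Qed.

(** The frieze rule and [contin_det] are the same relation; it determines the next entry because the
    entry multiplying it is positive. *)
Lemma frieze_contin i t : F i (i + t%:Z) = contin (corner_row i) 0 t.
Proof.
have [F0 F1 Frec] := hF.
suff : F i (i + t%:Z) = contin (corner_row i) 0 t /\
  F i (i + t.+1%:Z) = contin (corner_row i) 0 t.+1 by case.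
elim: t i => [|t IH] i; first by rewrite addr0 F0 F1.
split; first by case: (IH i).
case: t IH => [|t] IH.
  have := quiddity_corner (i + 1); rewrite /quiddity addrK -addrA => ->.
  by rewrite /= mulr1 subr0.
have [h1 h2] := IH i; have [h3 h4] := IH (i + 1).
have sh k : corner_row (i + 1) k = corner_row i (k + 1)%N.
  by rewrite /corner_row PoszD -addrA [1 + _]addrC.
rewrite !(contin_shift _ _ sh) !add0n in h3 h4.
have := Frec (i + 1) (i + t.+2%:Z) ltac:(lia); rewrite addrK.
have -> : i + t.+2%:Z + 1 = i + t.+3%:Z by lia.
have e4 : i + 1 + t.+2%:Z = i + t.+3%:Z by lia.
have e3 : i + 1 + t.+1%:Z = i + t.+2%:Z by lia.
rewrite e3 in h3; rewrite e4 in h4; rewrite h2 h3 h4.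
have det := contin_det (corner_row i) 0 t.+1.
have pos : contin (corner_row i) 1 t.+1 != 0.
  rewrite gt_eqF //; have := contin_corner_gt0 (i + 1) t.
  by rewrite (contin_shift _ _ sh) add0n.
move=> e; apply: (mulIf pos); move: e det; rewrite [0.+1]/=; lra.
Qed.

(** One solution [g] is followed along all lower vertices and along the bridging ones. Both forms of
    Cayley-Hamilton relate its values at [v0], [v0 + n] and [v0 + 2n], and the middle value is
    nonzero. *)
Lemma growth_chain v0 m : bvertex sf D v0 -> 0 <= v0 -> (0 < m)%N ->
  chain v0 m = v0 + n%:Z ->
  principal_growth n F = contin (chain_sum v0) 0 m.+1 - contin (chain_sum v0) 1 m.-1.
Proof.
move=> bv0 v0ge m0 cm; have n0 := strip_gt0 H.
have sh k : corner_row 1 k = corner_row 0 (k + 1)%N.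
  by rewrite /corner_row add0r PoszD addrC.
have -> : principal_growth n F = contin (corner_row 0) 0 n.+1 - contin (corner_row 0) 1 n.-1.
  rewrite /principal_growth; have := frieze_contin 0 n.+1; have := frieze_contin 1 n.-1.
  have -> : 1 + n.-1%:Z = n%:Z by lia.
  have -> : 0 + n.+1%:Z = n%:Z + 1 by lia.
  by rewrite (contin_shift _ _ sh) add0n => -> ->.
pose g k := contin (corner_row 0) 0 (absz (k - 0)%R).
have hg : solution sf D 0 g by exact: contin_solution.
have st k := chain_step H bv0 k.
have le k : 0 <= chain v0 k by have := chain_ge H bv0 k; lia.
have hrec k : g (chain v0 k.+2) + g (chain v0 k) = chain_sum v0 k.+1 * g (chain v0 k.+1).
  exact: (bstep_rec H hg (st k) (st k.+1) (le k)).
have cper k : chain v0 (k + m) = chain v0 k + n%:Z.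
  elim: k => [|k IH]; first by rewrite add0n.
  apply: (bstep_uniqr H (st (k + m)%N)); rewrite IH.
  by have := bstep_deck H 1 (st k); rewrite mul1r.
have sper k : chain_sum v0 (k + m)%N = chain_sum v0 k.
  by rewrite /chain_sum cper; have := bridging_sum_deck (chain v0 k) 1; rewrite mul1r.
have := contin_cayley hrec m0 sper 0; rewrite cper add0n cm => e1.
have hrec' k : contin (corner_row 0) 0 k.+2 + contin (corner_row 0) 0 k =
  corner_row 0 k.+1 * contin (corner_row 0) 0 k.+1 by rewrite contin_recr.
have qper k : corner_row 0 (k + n)%N = corner_row 0 k.
  by rewrite /corner_row !add0r -!quiddity_corner PoszD hper.
have := contin_cayley hrec' n0 qper (absz v0) => e2.
have eg (k : nat) : contin (corner_row 0) 0 (absz v0 + k)%N = g (v0 + k%:Z).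
  by rewrite /g; congr contin; lia.
have pos : g (v0 + n%:Z) != 0.
  have -> : g (v0 + n%:Z) = contin (corner_row 0) 0 (absz v0 + n).-1.+1.
    by rewrite /g; congr contin; lia.
  by rewrite gt_eqF // contin_corner_gt0.
have eg0 : contin (corner_row 0) 0 (absz v0) = g v0 by rewrite /g subr0.
rewrite -addnA !eg eg0 PoszD addrA in e2.
by apply: (mulIf pos); rewrite -e1 -e2.
Qed.

End Growth.

(** * Choice sums with constrained choices *)

Lemma choice_fun (K T : eqType) (x0 : T) (L : K -> seq T) ks s : uniq ks ->
  s \in choices [seq L k | k <- ks] ->
  exists f : K -> T, s = [seq f k | k <- ks] /\ forall k, k \in ks -> f k \in L k.
Proof.
move=> uks sk; exists (fun k => nth x0 s (index k ks)).
have sz : size s = size ks by rewrite (size_choice sk) size_map.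
split.
  apply: (@eq_from_nth _ x0); first by rewrite size_map.
  move=> i; rewrite sz => iks.
  case: ks uks sk sz iks => // k0 ks' uks sk sz iks.
  by rewrite (nth_map k0) // index_uniq.
move=> k kks; have ik : (index k ks < size ks)%N by rewrite index_mem.
have := nth_choice x0 sk (i := index k ks); rewrite size_map => /(_ ik).
by rewrite (nth_map k) // nth_index.
Qed.

Lemma big_choices_filter (R : nmodType) (K T : eqType) (L : K -> seq T)
    (p : K -> pred T) ks (f : seq T -> R) :
  (forall s, s \in choices [seq L k | k <- ks] -> f s != 0 -> all2 p ks s) ->
  \sum_(s <- choices [seq L k | k <- ks]) f s =
  \sum_(s <- choices [seq [seq x <- L k | p k x] | k <- ks]) f s.
Proof.
elim: ks f => [|k ks IH] f h //; rewrite !map_cons !big_choices_cons big_filter.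
rewrite [LHS](bigID (p k)) /= [X in _ + X]big_seq_cond [X in _ + X]big1 ?addr0.
  rewrite [LHS]big_seq_cond [RHS]big_seq_cond; apply: eq_bigr => x /andP[xL px].
  apply: IH => s sk fs.
  have := h (x :: s); rewrite mem_choices /= -mem_choices xL sk px => /(_ isT fs).
  by [].
move=> x /andP[xL px]; rewrite big_seq big1 // => s sk; apply/eqP.
apply: contraTT isT => fs; have := h (x :: s).
by rewrite mem_choices /= -mem_choices xL sk (negbTE px) => /(_ isT fs).
Qed.

Lemma big_choices_single (R : nmodType) (K T : eqType) (L : K -> seq T)
    (b : pred K) (q : pred T) ks (f : seq T -> R) :
  (forall k, k \in ks -> b k -> all q (L k)) ->
  (forall k, k \in ks -> ~~ b k -> exists2 x, L k = [:: x] & ~~ q x) ->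
  \sum_(s <- choices [seq L k | k <- ks]) f [seq x <- s | q x] =
  \sum_(s <- choices [seq L k | k <- ks & b k]) f s.
Proof.
elim: ks f => [|k ks IH] f h1 h2; first by rewrite /= !big_seq1.
have h1' k' : k' \in ks -> b k' -> all q (L k').
  by move=> kk; apply: h1; rewrite inE kk orbT.
have h2' k' : k' \in ks -> ~~ b k' -> exists2 x, L k' = [:: x] & ~~ q x.
  by move=> kk; apply: h2; rewrite inE kk orbT.
rewrite map_cons big_choices_cons [seq.filter b (k :: ks)]/=; case: (boolP (b k)) => bk.
  rewrite map_cons big_choices_cons big_seq [RHS]big_seq; apply: eq_bigr => x xL.
  have qx := allP (h1 k (mem_head _ _) bk) x xL.
  rewrite -(IH (fun s => f (x :: s))) //; apply: eq_bigr => s _.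
  by rewrite /= qx.
have [x -> nqx] := h2 k (mem_head _ _) bk.
rewrite big_seq1 -IH //; apply: eq_bigr => s _.
by rewrite /= (negbTE nqx).
Qed.

Lemma weight_map (R : comPzRingType) (T T' : eqType) (f : T -> T')
    (W : T -> nat -> R) (W' : T' -> nat -> R) s :
  {in s &, injective f} -> (forall x k, x \in s -> W' (f x) k = W x k) ->
  weight W' [seq f x | x <- s] = weight W s.
Proof.
move=> finj hW; rewrite /weight.
have pe : perm_eq (undup [seq f x | x <- s]) [seq f x | x <- undup s].
  apply: uniq_perm; first exact: undup_uniq.
    by rewrite map_inj_in_uniq ?undup_uniq // => x y; rewrite !mem_undup; apply: finj.
  move=> y; rewrite mem_undup; apply/mapP/mapP => -[x xs ->]; exists x => //.
    by rewrite mem_undup.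
  by rewrite -mem_undup.
rewrite (perm_big _ pe) big_map [LHS]big_seq [RHS]big_seq.
apply: eq_bigr => x; rewrite mem_undup => xs; rewrite hW //; congr (W _ _).
rewrite count_map; apply: eq_in_count => y ys /=.
by apply/eqP/eqP => [/finj ->|->].
Qed.

Lemma count_map_ge (K T : eqType) (f : K -> T) (x : T) ks js :
  uniq js -> (forall k, k \in js -> k \in ks /\ f k = x) ->
  (size js <= count_mem x [seq f k | k <- ks])%N.
Proof.
move=> ujs h; rewrite count_map -size_filter; apply: uniq_leq_size => // k /h[kks e].
by rewrite mem_filter kks /= e eqxx.
Qed.

Lemma count_map_le (K T J : eqType) (f : K -> T) (g : K -> J) (x : T) ks (js : seq J) :
  uniq ks -> {in ks &, injective g} ->
  (forall k, k \in ks -> f k = x -> g k \in js) ->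
  (count_mem x [seq f k | k <- ks] <= size js)%N.
Proof.
move=> uks ginj h; rewrite count_map -size_filter -(size_map g); apply: uniq_leq_size.
  rewrite map_inj_in_uniq ?filter_uniq // => a b.
  by rewrite !mem_filter => /andP[_ ?] /andP[_ ?]; apply: ginj.
by move=> y /mapP[k]; rewrite mem_filter => /andP[/eqP e kks] ->; apply: h.
Qed.

(** * Matchings as choice sequences *)

Section Rho.
Variable sf : surface.

Lemma rho_refl P : rho sf P P.
Proof. by exists 0; rewrite map_deck0. Qed.

Lemma rho_deck k P : rho sf (map (deck sf k) P) = rho sf P.
Proof.
apply/seteqP; split=> Q [l ->].
  by exists (l + k); rewrite map_deckD.
by exists (l - k); rewrite map_deckD subrK.
Qed.

Lemma gon_size_rho P : gon_size (rho sf P) = size P.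
Proof.
rewrite /gon_size; case: xgetP => [Q _ [k ->]|/(_ P (rho_refl P))//].
by rewrite size_map.
Qed.

End Rho.

Section Matchings.
Variables (R : realType) (n : nat) (sf : surface) (D : set (mpoint * mpoint)).
Hypothesis H : strip_dissection n sf D.
#[local] Set Default Proof Using "All".
Let hD := strip_dissected H.
Notation gons := (gons sf D).

(** Moves the vanishing condition of [wtA] into the individual factors, so that the weight becomes a
    product over classes. *)
Definition truncw (p k : nat) : R := if (k <= p - 2)%N then chebU k (lambda R p) else 0.

Definition class_weight (s : seq (seq mpoint)) : R :=
  weight (fun C k => truncw (gon_size C) k) [seq rho sf P | P <- s].

Definition window (i : int) : seq (seq (seq mpoint)) :=
  [seq gons (i + 1 + k%:Z) | k <- iota 0 n].

Let as_matching (s : seq (seq mpoint)) : {ffun 'I_n -> seq mpoint} :=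
  [ffun k : 'I_n => nth [::] s k].

Let as_matchingK s : size s = n -> [seq as_matching s k | k <- enum 'I_n] = s.
Proof.
move=> sn; apply: (@eq_from_nth _ [::]); first by rewrite size_map size_enum_ord.
move=> i; rewrite size_map size_enum_ord => i_n.
by rewrite (nth_map (Ordinal i_n)) ?size_enum_ord // ffunE nth_enum_ord.
Qed.

Let mult_as_matching s C : size s = n ->
  mult sf (as_matching s) C = count_mem C [seq rho sf P | P <- s].
Proof.
move=> sn; rewrite -{2}(as_matchingK sn) -map_comp count_map.
by rewrite /mult cardE size_filter enumT; apply: eq_count => k.
Qed.

Let wtA_as_matching s : size s = n -> (forall P, P \in s -> subgon sf D P) ->
  wtA R sf D (as_matching s) = class_weight s.
Proof.
move=> sn hs; rewrite /wtA /class_weight /weight; case: asboolP => [[C hC]|noC].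
  rewrite mult_as_matching // => lt; apply/esym.
  have Cs : C \in undup [seq rho sf P | P <- s].
    by rewrite mem_undup -has_pred1 has_count; apply: leq_ltn_trans lt.
  by rewrite (bigD1_seq C) ?undup_uniq //= /truncw leqNgt lt /= mul0r.
rewrite (fsbigE (undup [seq rho sf P | P <- s])) ?undup_uniq //.
- rewrite [RHS]big_seq [LHS]big_seq_cond; apply: eq_big => [C|C /andP[]].
    apply: andb_idr; rewrite mem_undup => /mapP[P Ps ->]; apply/mem_set.
    by exists P => //; apply: hs.
  rewrite mem_undup => Cs _.
  rewrite mult_as_matching // /truncw ifT // leqNgt; apply/negP => lt.
  apply: noC; exists C; last by rewrite mult_as_matching.
  by have [P Ps ->] := mapP Cs; exists P => //; apply: hs.
- move=> C /=; rewrite mem_undup => /mapP[P Ps ->]; exists P => //; exact: hs.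
- move=> C hC; rewrite mem_undup => Cs.
  by rewrite mult_as_matching // (count_memPn Cs).
Qed.

Lemma sum_matchings i :
  \sum_(w \in @matchings n sf D i) wtA R sf D w =
  \sum_(s <- choices (window i)) class_weight s.
Proof.
have szw : size (window i) = n by rewrite size_map size_iota.
have nthw k : (k < n)%N -> nth [::] (window i) k = gons (i + 1 + k%:Z).
  by move=> kn; rewrite (nth_map 0%N) ?size_iota // nth_iota.
have injm : {in choices (window i) &, injective as_matching}.
  move=> s t ss ts e; rewrite -(@as_matchingK s) ?(size_choice ss) //.
  by rewrite e as_matchingK // (size_choice ts).
have -> : \sum_(s <- choices (window i)) class_weight s =
  \sum_(w <- [seq as_matching s | s <- choices (window i)]) wtA R sf D w.
  rewrite big_map big_seq [RHS]big_seq; apply: eq_bigr => s ss.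
  have sn : size s = n by rewrite (size_choice ss).
  rewrite wtA_as_matching // => P /(nthP [::])[k]; rewrite sn => kn <-.
  by have := nth_choice [::] ss (i := k); rewrite szw nthw // => /(_ kn) /(gonsP H)[].
have -> : @matchings n sf D i = [set` [seq as_matching s | s <- choices (window i)]].
  apply/seteqP; split=> w.
    move=> wm; apply/mapP; exists [seq w k | k <- enum 'I_n].
      apply: (choices_nth (x0 := [::])).
        by rewrite size_map size_enum_ord szw.
      move=> k; rewrite szw => kn; rewrite nthw //.
      rewrite (nth_map (Ordinal kn)) ?size_enum_ord //.
      have -> : nth (Ordinal kn) (enum 'I_n) k = Ordinal kn.
        by apply: val_inj; rewrite /= nth_enum_ord.
      exact/(gonsP H)/(wm (Ordinal kn)).
    apply/ffunP => k; rewrite ffunE (nth_map k) ?size_enum_ord ?ltn_ord //.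
    by rewrite nth_ord_enum.
  move=> /mapP[s ss ->] k; rewrite ffunE.
  have := nth_choice [::] ss (i := k); rewrite szw nthw ?ltn_ord // => /(_ isT).
  by move/(gonsP H).
rewrite -fsbig_seq //.
rewrite map_inj_in_uniq //; apply: choices_uniq; apply/allP => L /mapP[k _ ->].
exact: (gons_uniq H).
Qed.

Lemma class_weight_perm s t : perm_eq s t -> class_weight s = class_weight t.
Proof.
move=> st; apply: weight_perm; last exact: perm_map.
by move=> C; rewrite /truncw.
Qed.

Lemma class_weight_deck k P s :
  class_weight (map (deck sf k) P :: s) = class_weight (P :: s).
Proof. by rewrite /class_weight !map_cons rho_deck. Qed.

(** Sliding the window trades the vertex [i + 1] for its translate; translated polygons have the
    same class, and the weight ignores the order. *)
Let rotate i : \sum_(s <- choices (window (i + 1))) class_weight s =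
  \sum_(s <- choices (window i)) class_weight s.
Proof.
have [m en] : exists m, n = m.+1 by exists n.-1; rewrite prednK // (strip_gt0 H).
pose mid := [seq gons (i + 1 + k%:Z) | k <- iota 1 m].
have -> : window i = gons (i + 1) :: mid by rewrite /window en /= addr0.
have -> : window (i + 1) = rcons mid (gons (i + 1 + 1 * n%:Z)).
  rewrite /window en -[in iota 0 m.+1]addn1 iotaD map_cat /= cats1 mul1r; congr rcons.
    rewrite /mid -[1%N]/(1 + 0)%N iotaDl -map_comp; apply: eq_map => k /=.
    by congr gons; lia.
  by congr gons; lia.
rewrite big_choices_rcons; last exact: class_weight_perm.
rewrite !big_choices_cons (perm_big _ (gons_deck H (i + 1) 1)) big_map.
by apply: eq_bigr => P _; apply: eq_bigr => s _; rewrite class_weight_deck.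
Qed.

Lemma sum_window i j : \sum_(s <- choices (window i)) class_weight s =
  \sum_(s <- choices (window j)) class_weight s.
Proof.
have up k (t : nat) : \sum_(s <- choices (window (k + t%:Z))) class_weight s =
  \sum_(s <- choices (window k)) class_weight s.
  elim: t => [|t IH]; first by rewrite addr0.
  by rewrite -addn1 PoszD addrA rotate.
have [ij|ji] := leP i j.
  by rewrite -(up i (absz (j - i)%R)); congr (\sum_(s <- choices (window _)) _); lia.
by rewrite -(up j (absz (i - j)%R)); congr (\sum_(s <- choices (window _)) _); lia.
Qed.

End Matchings.

(** * A fundamental domain *)

Section Home.
Variables (n : nat) (sf : surface) (D : set (mpoint * mpoint)).
Hypothesis H : strip_dissection n sf D.
#[local] Set Default Proof Using "All".
Let hD := strip_dissected H.
Notation gons := (gons sf D).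

Lemma within_deck k x y P : marked sf x -> marked sf y -> subgon sf D P ->
  within (deck sf k x) (deck sf k y) (map (deck sf k) P) = within x y P.
Proof.
move=> mx my hP; rewrite /within all_map; apply: eq_in_all => z zP /=.
by rewrite /between !blt_deck // (subgon_marked hD hP).
Qed.

Lemma without_deck k x y P : marked sf x -> marked sf y -> subgon sf D P ->
  without (deck sf k x) (deck sf k y) (map (deck sf k) P) = without x y P.
Proof.
move=> mx my hP; rewrite /without all_map; apply: eq_in_all => z zP /=.
by rewrite !blt_deck // (subgon_marked hD hP).
Qed.

Lemma not_without x y P : edge sf D x y -> subgon sf D P ->
  ~~ without x y P = within x y P.
Proof.
move=> e hP; apply/idP/idP => [|w]; last exact: (within_without H hP w).
by have [//|->] := side hD e hP.
Qed.

Section Base.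
Variables (v0 : int) (z0 : mpoint).
Hypothesis hb : bbase D v0 z0.
Let z1 := deck sf 1 z0.
Let hb1 : bbase D (v0 + n%:Z) z1.
Proof. by have := bbase_deck H 1 hb; rewrite mul1r. Qed.

(** The polygons between the cut and its translate. *)
Definition home (P : seq mpoint) : Prop := [/\ subgon sf D P,
  within (Low v0) z0 P & without (Low (v0 + n%:Z)) z1 P].

Lemma home_inner P k : P \in gons k -> v0 < k < v0 + n%:Z -> home P.
Proof.
move=> /(gonsP H)[hP kP] /andP[k0 k1]; split=> //.
  exact: (bbase_right H hb hP kP).
exact: (bbase_left H hb1 hP kP).
Qed.

(** The corners at the cut vertex, seen from the fundamental domain, are shared between its two
    lifts. A polygon touching both lifts is listed on both sides, once for each corner. *)
Definition left_home : seq (seq mpoint) :=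
  [seq P <- gons (v0 + n%:Z) | without (Low (v0 + n%:Z)) z1 P].
Definition right_home : seq (seq mpoint) :=
  [seq P <- gons v0 | within (Low v0) z0 P].

Lemma left_homeP P : P \in left_home -> home P /\ Low (v0 + n%:Z) \in P.
Proof.
rewrite mem_filter => /andP[wo /(gonsP H)[hP kP]]; do 2 split=> //.
by apply: (bbase_right H hb hP kP); have := strip_gt0 H; lia.
Qed.

Lemma right_homeP P : P \in right_home -> home P /\ Low v0 \in P.
Proof.
rewrite mem_filter => /andP[wo /(gonsP H)[hP kP]]; do 2 split=> //.
by apply: (bbase_left H hb1 hP kP); have := strip_gt0 H; lia.
Qed.

Lemma home_range P j : home P -> Low j \in P -> v0 <= j <= v0 + n%:Z.
Proof.
move=> [hP /withinP w /withoutP wo] jP; move: (w _ jP) (wo _ jP).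
have [_ i1] := hb1; move: i1; rewrite /between /blt; clear.
by case: (z1) => //= *; lia.
Qed.

(** The polygons at [v0 + n] to the right of the second cut are the translates of those at [v0] to
    the right of the first. *)
Lemma home_sum (R : nmodType) (f : seq mpoint -> R) :
  (forall P, f (map (deck sf 1) P) = f P) ->
  \sum_(P <- gons (v0 + n%:Z)) f P = \sum_(P <- left_home ++ right_home) f P.
Proof.
move=> fd; rewrite big_cat /= !big_filter.
rewrite (bigID (without (Low (v0 + n%:Z)) z1)) /=; congr (_ + _).
have := gons_deck H v0 1; rewrite mul1r => pe.
have [d0 i0] := hb; have [mv mz _ _] := arc_marked hD d0.
have ed : edge sf D (Low v0) z0 by right.
rewrite (perm_big _ pe) big_map big_seq_cond [RHS]big_seq_cond.
apply: eq_big => [P|P _]; last exact: fd.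
have [/(gonsP H)[hP _]|//] := boolP (P \in gons v0).
have -> : Low (v0 + n%:Z) = deck sf 1 (Low v0) by rewrite (deckL H) mul1r.
by rewrite without_deck // not_without.
Qed.

(** A positive translate of a polygon right of the first cut is right of the second one. *)
Let home_noshift P Q t : home P -> home Q -> P = map (deck sf t) Q -> ~ (0 < t).
Proof.
move=> [hP _ wo] [hQ w _] e t0.
have [d0 i0] := hb; have [mv mz _ _] := arc_marked hD d0.
move: w; rewrite -(@within_deck t) // -e (deckL H) => w.
suff w1 : within (Low (v0 + n%:Z)) z1 P by have := within_without H hP w1; rewrite wo.
apply: (within_trans H _ _ w).
  have : n%:Z <= t * n%:Z by rewrite ler_peMl //; lia.
  by rewrite /blt /=; lia.
rewrite /z1; move: i0 mz; have := strip_surface H; clear -t0.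
case=> [[m m0 ->]|->]; case: z0 => [?|j|] //.
  have : m%:Z <= t * m%:Z by rewrite ler_peMl //; lia.
  by rewrite /blt /=; lia.
Qed.

Lemma home_rho_inj P Q : home P -> home Q -> rho sf P = rho sf Q -> P = Q.
Proof.
move=> homeP homeQ e; have : rho sf Q P by rewrite -e; exact: rho_refl.
move=> [t et]; have [t0|t0|t0] := ltgtP t 0; last by rewrite et t0 map_deck0.
  case: (@home_noshift Q P (- t)) => //; last by lia.
  by rewrite et map_deckD addNr map_deck0.
by case: (@home_noshift P Q t).
Qed.

End Base.

(** * Interior points of polygons without inner vertices *)

Definition ipts (P : seq mpoint) : seq int :=
  [seq zkey (pt P i) | i <- iota 1 (size P - 2)].

Definition span (P : seq mpoint) : nat :=
  absz (zkey (pt P (size P).-1) - zkey (pt P 0))%R.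

Section Low.
Variable P : seq mpoint.
Hypotheses (hP : subgon sf D P) (loP : ~~ is_bridging P).

Lemma iptsP k : reflect (exists2 i, (i.+2 < size P)%N & pt P i.+1 = Low k) (k \in ipts P).
Proof.
have sP := subgon_size hP; apply: (iffP mapP) => [[i]|[i iP e]].
  rewrite mem_iota => iP ->; case: i iP => // i iP.
  by exists i; [lia|apply: (low_pt H loP); lia].
by exists i.+1; rewrite ?mem_iota ?e //; lia.
Qed.

Lemma ipts_mem k : k \in ipts P -> Low k \in P.
Proof. by move=> /iptsP[i iP <-]; apply: mem_pt; lia. Qed.

Lemma low_ends : exists x y, [/\ pt P 0 = Low x, pt P (size P).-1 = Low y,
  edge sf D (Low x) (Low y) & forall k, k \in ipts P -> x < k < y].
Proof.
have sP := subgon_size hP.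
have P0 : (0 < size P)%N by lia.
have P1 : ((size P).-1 < size P)%N by lia.
have [x ex] := low_vertex loP (mem_pt P0); have [y ey] := low_vertex loP (mem_pt P1).
exists x, y; split=> //; first by rewrite -ex -ey; apply: subgon_base.
move=> k /iptsP[i iP e]; have iP' : (i.+1 < size P)%N by lia.
have := pt_ltE hD hP P0 iP'; have := pt_ltE hD hP iP' P1.
rewrite ex ey e /blt /=; lia.
Qed.

Lemma ipts_not_bvertex k : k \in ipts P -> ~ bvertex sf D k.
Proof. by have [x [y [_ _ e h]]] := low_ends; move=> /h; apply: (lowedge_cover H e). Qed.

Lemma ipts_uniq : uniq (ipts P).
Proof.
have sP := subgon_size hP.
rewrite map_inj_in_uniq ?iota_uniq // => i j; rewrite !mem_iota => iP jP e.
have iP' : (i < size P)%N by lia.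
have jP' : (j < size P)%N by lia.
by apply: (pt_inj hD hP) => //; rewrite (low_pt H loP iP') (low_pt H loP jP') e.
Qed.

Lemma size_ipts : size (ipts P) = (size P - 2)%N.
Proof. by rewrite size_map size_iota. Qed.

End Low.

(** At an interior point [k] of [P], another polygon lies in a gap of [P] that ends at [k]. So it is
    shorter, and [k] is not interior to it. *)
Lemma ipts_other P Q k : subgon sf D P -> ~~ is_bridging P -> k \in ipts P ->
  subgon sf D Q -> Low k \in Q -> Q <> P ->
  [/\ ~~ is_bridging Q, (span Q < span P)%N & k \notin ipts Q].
Proof.
move=> hP loP kP hQ kQ neq; have [i iP ek] := iptsP hP loP k kP.
have [x [y [ex ey exy hxy]]] := low_ends hP loP.
have i0 : (i < size P)%N by lia.
have i1 : (i.+1 < size P)%N by lia.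
have sP := subgon_size hP.
have P0 : (0 < size P)%N by lia.
have P1 : ((size P).-1 < size P)%N by lia.
have [a ea] := low_vertex loP (mem_pt i0); have [c ec] := low_vertex loP (mem_pt iP).
have := pt_ltE hD hP i0 P0; have := pt_ltE hD hP P1 iP.
have := pt_ltE hD hP i0 i1; have := pt_ltE hD hP i1 iP.
rewrite ea ek ec ex ey /blt /= => h1 h2 h3 h4.
have [u [v [wQ uv hu hv hk]]] : exists u v, [/\ within (Low u) (Low v) Q,
    x <= u, v <= y, (v - u < y - x) & (k <= u) || (v <= k)].
  rewrite -ek in kQ; have [//||] := gons_interior H hP hQ iP kQ; rewrite ?ea ?ec ?ek => w.
    by exists a, k; split=> //; try lia; rewrite lexx orbT.
  by exists k, c; split=> //; try lia; rewrite lexx.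
have loQ := within_low H wQ; have [x' [y' [ex' ey' exy' hxy']]] := low_ends hQ loQ.
have sQ := subgon_size hQ.
have Q0 : (0 < size Q)%N by lia.
have Q1 : ((size Q).-1 < size Q)%N by lia.
move/withinP: wQ => wQ; move: (wQ _ (mem_pt Q0)) (wQ _ (mem_pt Q1)).
rewrite ex' ey' /between /blt /= => h5 h6.
have := lowedge_span H exy'; have := lowedge_span H exy => h7 h8.
split=> //; first by rewrite /span ex ey ex' ey' /=; lia.
by apply/negP => /hxy'; lia.
Qed.

(** Descend from the step over [k] through the polygons below successive arcs, until [k] is a vertex
    strictly between the ends of the arc. *)
Lemma ipts_exists k : ~ bvertex sf D k ->
  exists P, [/\ subgon sf D P, ~~ is_bridging P & k \in ipts P].
Proof.
move=> nbk; have [a [b [st ab]]] := bstep_around H k.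
have [ba _] := bstep_bvertex H st; have e := bstep_edge H st.
have nak : a != k by apply/eqP => eak; apply: nbk; rewrite -eak.
have akb : a < k < b by lia.
move: akb e; clear nbk st ab ba nak; have [m] := ubnP (absz (b - a)%R).
elim: m a b => // m IH x y mlt xky exy.
case: (exy) => [s|d]; first by move: s xky; case: (sf) => //= *; lia.
have [P [hP e0 e1]] := inside_polygon H d.
have lo := low_between H e0 e1 hP; have sP := subgon_size hP.
have := @subgon_locate sf D hD P hP (Low k).
have P0 : (0 < size P)%N by lia.
have P1 : ((size P).-1 < size P)%N by lia.
rewrite e0 e1 => -[||/mem_ptP[i iP ei]|[i iP]]; first by case: (sf).
- by rewrite /between /blt /=; lia.
- exists P; split=> //; apply/(iptsP hP lo).
  have := pt_ltE hD hP P0 iP; have := pt_ltE hD hP iP P1.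
  rewrite e0 e1 ei /blt /= => h1 h2; have i0 : (0 < i)%N by lia.
  by exists i.-1; rewrite prednK //; lia.
have iP' : (i < size P)%N by lia.
have [a ea] := low_vertex lo (mem_pt iP'); have [c ec] := low_vertex lo (mem_pt iP).
have := pt_ltE hD hP iP' P0; have := pt_ltE hD hP P1 iP.
have := pt_ltE hD hP P0 iP'; have := pt_ltE hD hP iP P1.
have := subgon_edge hP iP; rewrite ea ec e0 e1 /blt /= => eac h1 h2 h3 h4 h5.
by apply: (IH a c) => //; have := lowedge_span H eac; lia.
Qed.

End Home.

(** * The state sum *)

Lemma all2_map_self (K T : Type) (p : K -> pred T) (f : K -> T) ks :
  all2 p ks (map f ks) = all (fun k => p k (f k)) ks.
Proof. by elim: ks => //= k ks ->. Qed.

Lemma uniq_eq_seq1 (T : eqType) (s : seq T) x :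
  uniq s -> x \in s -> (forall y, y \in s -> y = x) -> s = [:: x].
Proof.
case: s => [|a [|b s]] //= us _ h; first by rewrite (h a) ?mem_head.
have ea := h a (mem_head _ _); have eb := h b.
by move: us; rewrite ea eb ?inE ?eqxx ?orbT.
Qed.

Lemma big_seq_only (R : nmodType) (T : eqType) (s : seq T) x (f : T -> R) :
  uniq s -> x \in s -> (forall y, y \in s -> y != x -> f y = 0) ->
  \sum_(y <- s) f y = f x.
Proof.
move=> us xs h; rewrite (bigD1_seq x) //= big_seq_cond big1 ?addr0 //.
by move=> y /andP[]; apply: h.
Qed.

Section StateSum.
Variables (R : realType) (n : nat) (sf : surface) (D : set (mpoint * mpoint)).
Hypothesis H : strip_dissection n sf D.
Variables (v0 : int) (z0 : mpoint).
Hypothesis hb : bbase D v0 z0.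
#[local] Set Default Proof Using "All".
Let hD := strip_dissected H.
Let bv0 := bbase_bvertex H hb.
Notation gons := (gons sf D).
Notation bgons := (bgons sf D).
Notation chain := (chain sf D v0).
Notation lam := (fun P : seq mpoint => lambda R (size P)).
Notation home := (home n sf D v0 z0).
Notation lefth := (left_home n sf D v0 z0).
Notation righth := (right_home sf D v0 z0).

Let ks : seq int := [seq v0 + k%:Z | k <- iota 0 n].

(** Choices at [k] by representatives in the fundamental domain; only the cut vertex needs both of
    its lifts. *)
Let slot (k : int) : seq (seq mpoint) :=
  if k == v0 then lefth ++ righth else gons k.

Let tw (P : seq mpoint) (k : nat) : R := truncw R (size P) k.

Let mem_ks k : (k \in ks) = (v0 <= k < v0 + n%:Z).
Proof.
apply/mapP/idP => [[i]|h]; first by rewrite mem_iota => ? ->; lia.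
by exists (absz (k - v0)%R); rewrite ?mem_iota; lia.
Qed.

Let uniq_ks : uniq ks.
Proof. by rewrite map_inj_uniq ?iota_uniq // => i j /addrI[]. Qed.

Let slotP k P : k \in ks -> P \in slot k ->
  home P /\ if k == v0 then Low v0 \in P \/ Low (v0 + n%:Z) \in P else Low k \in P.
Proof.
rewrite mem_ks /slot => hk; case: eqVneq => [_|nk].
  by rewrite mem_cat => /orP[/(left_homeP H hb)[]|/(right_homeP H hb)[]] *; split=> //; [right|left].
move=> Pk; split; first by apply: (home_inner H hb Pk); lia.
by have [] := gonsP H k P Pk.
Qed.

Let sum_slots : \sum_(s <- choices (window n sf D v0)) class_weight R sf s =
  \sum_(s <- choices [seq slot k | k <- ks]) weight tw s.
Proof.
transitivity (\sum_(s <- choices [seq slot k | k <- ks]) class_weight R sf s).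
  have [m en] : exists m, n = m.+1 by exists n.-1; rewrite prednK // (strip_gt0 H).
  have -> : [seq slot k | k <- ks] =
      (lefth ++ righth) :: [seq gons (v0 + 1 + k%:Z) | k <- iota 0 m].
    have -> : ks = v0 :: [seq v0 + 1 + k%:Z | k <- iota 0 m].
      rewrite /ks en; apply: (@eq_from_nth _ 0); rewrite /= ?size_map ?size_iota //.
      move=> [|i] im; rewrite /= ?addr0 // !(nth_map 0%N) ?size_iota //.
      by rewrite !nth_iota //; lia.
    rewrite map_cons {1}/slot eqxx -map_comp; congr cons; apply: eq_map => k /=.
    by rewrite /slot ifF //; lia.
  have -> : window n sf D v0 =
      rcons [seq gons (v0 + 1 + k%:Z) | k <- iota 0 m] (gons (v0 + n%:Z)).
    rewrite /window en -[in iota 0 m.+1]addn1 iotaD map_cat /= cats1; congr rcons.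
    by congr gons; lia.
  rewrite big_choices_rcons; last exact: (class_weight_perm R H).
  rewrite !big_choices_cons; apply: (home_sum H hb) => P.
  by apply: eq_bigr => s _; apply: (class_weight_deck R H).
rewrite big_seq [RHS]big_seq; apply: eq_bigr => s sk.
have [f [-> hf]] := choice_fun [::] uniq_ks sk.
have hh P : P \in map f ks -> home P.
  by move=> /mapP[k kks ->]; have [] := slotP kks (hf k kks).
apply: weight_map => [P Q /hh hP /hh hQ|P k _]; first exact: (home_rho_inj H hb).
by rewrite /tw gon_size_rho.
Qed.

Let ipts_ks P k : home P -> ~~ is_bridging P -> k \in ipts P -> k \in ks /\ k != v0.
Proof.
move=> hh lo kP; have [hP _ _] := hh.
have [x [y [ex ey _ hxy]]] := low_ends H hP lo; have sP := subgon_size hP.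
have xP : Low x \in P by rewrite -ex mem_pt //; lia.
have yP : Low y \in P by rewrite -ey mem_pt //; lia.
have := home_range H hb hh xP; have := home_range H hb hh yP; have := hxy k kP.
rewrite mem_ks; lia.
Qed.

Let admissible k P : bool :=
  if `[< bvertex sf D k >] then is_bridging P else ~~ is_bridging P && (k \in ipts P).

(** * The choices forced by a nonzero weight *)

Section Forced.
Variable f : int -> seq mpoint.
Hypothesis hf : forall k, k \in ks -> f k \in slot k.
Let s := [seq f k | k <- ks].
Hypothesis ws : weight tw s != 0.

Let weight_count P : P \in s -> (count_mem P s <= size P - 2)%N.
Proof.
move=> Ps; rewrite leqNgt; apply: contra ws => lt.
rewrite /weight (bigD1_seq P) ?undup_uniq ?mem_undup //= /tw /truncw leqNgt lt /=.
by rewrite mul0r.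
Qed.

(* Otherwise [Q] would be chosen [size Q - 1] times. *)
Let overfull Q k : k \in ks -> f k = Q -> subgon sf D Q -> ~~ is_bridging Q ->
  (forall j, j \in ipts Q -> j \in ks /\ f j = Q) -> k \in ipts Q.
Proof.
move=> kks fk hQ lo full; apply: contraT => kQ.
have Qs : Q \in s by rewrite -fk map_f.
have := weight_count Qs; have sQ := subgon_size hQ.
have := @count_map_ge _ _ f Q ks (k :: ipts Q).
rewrite /= kQ (ipts_uniq H hQ lo) (size_ipts H hQ lo) => /(_ isT) le le'.
have absurd (a N : nat) : (2 < a -> N <= a - 2 -> a - 1 <= N -> False)%N by lia.
exfalso; apply: (absurd _ _ sQ le').
have -> : (size Q - 1 = (size Q - 2).+1)%N by lia.
by apply: le => j; rewrite inE => /orP[/eqP ->|/full].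
Qed.

(** Induction on the span. A different choice at [k] would be a shorter low polygon, chosen by
    induction at all its interior points and also at its end [k], which is excluded by
    [overfull]. *)
Let forced P k : home P -> ~~ is_bridging P -> k \in ipts P -> f k = P.
Proof.
have [m] := ubnP (span P); elim: m P k => // m IH P k mlt hh lo kP.
have [kks nk] := ipts_ks hh lo kP; have [hP _ _] := hh.
have [hQ] := slotP kks (hf kks); rewrite (negbTE nk) => kQ.
have [sQ _ _] := hQ; apply: contrapT => neq.
have [loQ lt nkQ] := ipts_other H hP lo kP sQ kQ neq.
have : k \in ipts (f k); last by rewrite (negbTE nkQ).
apply: overfull => // j jQ; have [jks _] := ipts_ks hQ loQ jQ; split=> //.
by apply: IH => //; lia.
Qed.

Lemma forced_admissible : all (fun k => admissible k (f k)) ks.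
Proof.
apply/allP => k kks; have [hh kP] := slotP kks (hf kks); have [hP _ _] := hh.
rewrite /admissible; case: asboolP => bk.
  apply: contraT => lo; have : k \in ipts (f k).
    apply: overfull => // j jP; have [jks _] := ipts_ks hh lo jP; split=> //.
    exact: forced.
  by move=> /(ipts_not_bvertex H hP lo) /(_ bk).
have nk : k != v0 by apply/eqP => e; apply: bk; rewrite e.
have [P [hP' lo kP']] := ipts_exists H bk.
have Pk : P \in gons k by apply/(gonsP H); split=> //; apply: (ipts_mem H hP' lo).
have hh' : home P by apply: (home_inner H hb Pk); move: kks; rewrite mem_ks; lia.
by rewrite (forced hh' lo kP') lo kP'.
Qed.

End Forced.

Let fslot k := [seq P <- slot k | admissible k P].

Let ipts_inj P Q k : subgon sf D P -> ~~ is_bridging P -> k \in ipts P ->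
  subgon sf D Q -> ~~ is_bridging Q -> k \in ipts Q -> Q = P.
Proof.
move=> hP loP kP hQ loQ kQ; apply: contrapT => neq.
have [_ _] := ipts_other H hP loP kP hQ (ipts_mem H hQ loQ kQ) neq.
by rewrite kQ.
Qed.

(** Low polygons drop out because each is chosen exactly at its p - 2 interior points, and
    U_(p-2)(lambda p) = 1. *)
Let weight_bridging s : s \in choices [seq fslot k | k <- ks] ->
  weight tw s = weight (natw lam) [seq P <- s | is_bridging P].
Proof.
move=> sk; have [f [es hf]] := choice_fun [::] uniq_ks sk.
have hs k : k \in ks -> admissible k (f k) /\ f k \in slot k.
  by move=> kks; have := hf k kks; rewrite mem_filter => /andP[].
rewrite (@weight_ext _ _ (natw lam) _ (undup s)) ?undup_uniq //; last first.
  by move=> P; rewrite mem_filter mem_undup => /andP[].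
rewrite {1}/weight big_seq [RHS]big_seq; apply: eq_bigr => P; rewrite mem_undup => Ps.
have [k0 k0ks ek0] : exists2 k, k \in ks & P = f k by apply/mapP; rewrite -es.
have [_ sl0] := hs _ k0ks; have [hh _] := slotP k0ks sl0; rewrite -ek0 in hh.
have [hP _ _] := hh; have sP := subgon_size hP.
rewrite count_filter; have [br|lo] := boolP (is_bridging P).
  rewrite (@eq_count _ _ (pred1 P)) => [|Q /=]; last by case: eqP => // ->; rewrite br.
  rewrite /tw /truncw /natw; case: leqP => // lt.
  have le : (count_mem P s <= size [seq z <- P | ~~ inner z])%N.
    (* Injects the positions that choose [P] into its low vertices; at the cut vertex the lift lying
       in [P] is used. *)
    rewrite es; pose g k := if k == v0 then
      (if Low v0 \in P then Low v0 else Low (v0 + n%:Z)) else Low k.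
    apply: (@count_map_le _ _ _ f g) => //.
      move=> i j; rewrite !mem_ks /g => hi hj.
      case: (eqVneq i v0) => [ei|ni]; case: (eqVneq j v0) => [ej|nj].
      - by rewrite ei ej.
      - by case: ifP => _ [e]; lia.
      - by case: ifP => _ [e]; lia.
      - by case.
    move=> k kks fk; have [_] := hs _ kks; rewrite fk => /(slotP kks)[_].
    rewrite mem_filter /g; case: eqP => // _.
    by case: (boolP (Low v0 \in P)) => [->//|_] [//|->].
  have : (count_mem P s < size P)%N.
    apply: leq_ltn_trans le _.
    rewrite size_filter -(count_predC inner P) -[ltnLHS]add0n ltn_add2r.
    by rewrite -has_count.
  (* Truncation can matter only at p - 1 choices, where the untruncated factor is already zero. *)
  have squeeze (a N : nat) : (2 < a -> a - 2 < N -> N < a -> N = a - 1)%N by lia.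
  move=> /(squeeze _ _ sP lt) ->.
  by rewrite chebU_lambda_subn1.
have -> : count (predI (pred1 P) is_bridging) s = 0%N.
  apply/eqP; rewrite -leqn0 leqNgt -has_count; apply/hasPn => Q _ /=.
  by case: eqP => // ->; rewrite (negbTE lo).
have -> : count_mem P s = (size P - 2)%N.
  apply/eqP; rewrite eqn_leq -(size_ipts H hP lo) es; apply/andP; split.
    apply: (@count_map_le _ _ _ f id) => // k kks fk; have [] := hs _ kks.
    by rewrite fk /admissible (negbTE lo); case: asboolP.
  apply: count_map_ge; first exact: (ipts_uniq H hP lo).
  move=> k kP; have [kks nk] := ipts_ks hh lo kP; split=> //.
  have [] := hs _ kks; rewrite /admissible.
  case: asboolP => [/(ipts_not_bvertex H hP lo kP)//|_] /andP[lok kk] slk.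
  have [[hk _ _] _] := slotP kks slk.
  exact: ipts_inj kk.
by rewrite /tw /truncw leqnn /natw chebU_lambda_subn2.
Qed.

Let sum_admissible : \sum_(s <- choices [seq slot k | k <- ks]) weight tw s =
  natsum lam [seq fslot k | k <- ks & `[< bvertex sf D k >]].
Proof.
rewrite (@big_choices_filter _ _ _ slot admissible) => [|s sk ws]; last first.
  have [f [es hf]] := choice_fun [::] uniq_ks sk.
  by rewrite es all2_map_self; apply: forced_admissible => //; rewrite -es.
rewrite -/fslot big_seq.
under eq_bigr => s sk do rewrite weight_bridging //.
rewrite -big_seq.
apply: (@big_choices_single _ _ _ fslot (fun k => `[< bvertex sf D k >]) is_bridging
  ks (weight (natw lam))).
- by move=> k _ bk; apply/allP => P; rewrite mem_filter /admissible bk => /andP[].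
- move=> k kks nbk; move/asboolPn: (nbk) => nb.
  have nk : k != v0 by apply/eqP => e; apply: nb; rewrite e.
  have [P [hP lo kP]] := ipts_exists H nb; exists P => //.
  have Pk : P \in gons k by apply/(gonsP H); split=> //; apply: (ipts_mem H hP lo).
  apply: uniq_eq_seq1.
  + by rewrite filter_uniq // /slot (negbTE nk) (gons_uniq H).
  + by rewrite mem_filter /admissible (negbTE nbk) lo kP /slot (negbTE nk) Pk.
  + move=> Q; rewrite mem_filter /admissible (negbTE nbk) /slot (negbTE nk).
    by move=> /andP[/andP[loQ kQ] /(gonsP H)[hQ _]]; apply: ipts_inj kQ.
Qed.

Variable m : nat.
Hypothesis m_gt0 : (0 < m)%N.
Hypothesis chain_m : chain m = v0 + n%:Z.

Let bvertices : [seq k <- ks | `[< bvertex sf D k >]] = [seq chain j | j <- iota 0 m].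
Proof.
apply: (@lt_sorted_eq _ int).
- apply: sorted_filter; first exact: lt_trans.
  rewrite sorted_map; apply: (sub_sorted (e := ltn)); last exact: iota_ltn_sorted.
  by move=> i j /= ij; rewrite ltrD2l ltz_nat.
- rewrite sorted_map; apply: (sub_sorted (e := ltn)); last exact: iota_ltn_sorted.
  by move=> i j /= ij; apply: (chain_lt H bv0).
move=> k; rewrite mem_filter mem_ks; apply/andP/mapP => [[/asboolP bk hk]|[j jm ->]].
  have [|t et] := chain_onto H bv0 _ bk; first by case/andP: hk.
  exists t => //; rewrite mem_iota /= add0n -(chain_ltE H bv0) et chain_m.
  by case/andP: hk.
split; first by apply/asboolP; apply: (chain_bvertex H bv0).
rewrite -chain_m (chain_ltE H bv0); move: jm; rewrite mem_iota /= add0n => ->.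
by have := chain_ge H bv0 j; lia.
Qed.

Let b1 := [seq P <- lefth | is_bridging P].
Let b2 := [seq P <- righth | is_bridging P].

Let slots_chain : [seq fslot k | k <- [seq chain j | j <- iota 0 m]] =
  (b1 ++ b2) :: chain_gons sf D v0 1 m.-1.
Proof.
have [m' em] : exists m', m = m'.+1 by exists m.-1; rewrite prednK.
rewrite em /=; congr cons.
  rewrite /fslot /slot eqxx -filter_cat; apply: eq_filter => P.
  by rewrite /admissible; case: asboolP.
rewrite -map_comp; apply/eq_in_map => j; rewrite mem_iota => jm /=.
rewrite /fslot /slot /bgons ifF; last first.
  by apply/negbTE; rewrite gt_eqF // (chain_ltE H bv0 0); lia.
apply: eq_filter => P; rewrite /admissible; case: asboolP => // -[].
exact: (chain_bvertex H bv0).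
Qed.

Let chain_edge_gon j : exists x, [/\ subgon sf D x, is_bridging x,
  Low (chain j) \in x & Low (chain j.+1) \in x].
Proof.
have [x [hx brx [i iP [ei ej]]]] := chain_step H bv0 j.
by exists x; split=> //; rewrite -?ei -?ej mem_pt //; lia.
Qed.

(** Right of the cut, only the polygon on the first step can be chosen again later. For [m = 1]
    there is nothing left to choose, in agreement with a continuant of length 0. *)
Let right_defects : \sum_(P <- b2) \sum_(s <- choices (chain_gons sf D v0 1 m.-1))
  defect lam P s = contin (chain_sum R sf D v0) 1 m.-1.
Proof.
have st := chain_step H bv0.
have [x [hx brx x0 x1]] := chain_edge_gon 0.
have b2P P : P \in b2 -> [/\ subgon sf D P, is_bridging P & Low v0 \in P].
  by rewrite mem_filter => /andP[br /(right_homeP H hb)[[hP _ _]]].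
have xb : x \in b2.
  rewrite !mem_filter brx /=; apply/andP; split; last by apply/(gonsP H).
  by apply: (bbase_right H hb hx x1); apply: (bstep_lt H (st 0%N)).
have ub : uniq b2 by rewrite !filter_uniq // (gons_uniq H).
rewrite (big_seq_only ub xb); last first.
  move=> y /b2P[hy bry y0] nyx; apply: defect_sum0; apply: contra nyx.
  move=> /(mem_chain_gons H bv0)[k [kt _ _ ky]]; apply/eqP.
  have lt : chain 0 < chain k by rewrite (chain_ltE H bv0); lia.
  have [i iP [_ e1]] := bgon_next H hy bry y0 ky lt (st 0%N).
  have y1 : Low (chain 1) \in y by rewrite -e1 mem_pt.
  exact: (bgon_edge_uniq H hx brx hy bry (st 0%N) x0 x1 y0 y1).
case em: (m.-1) => [|m']; first by rewrite /= big_seq1 defect_notin.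
rewrite -(natsum_chain R H _ _ bv0); apply: defect_sum.
- exact: (bgons_uniq H).
- by apply/(bgonsP H).
move=> /(mem_chain_gons H bv0)[k [kt _ _ kx]] y /(bgonsP H)[hy y1 bry].
have lt : chain 1 < chain k by rewrite (chain_ltE H bv0); lia.
have [i iP [_ e2]] := bgon_next H hx brx x1 kx lt (st 1%N).
have x2 : Low (chain 2) \in x by rewrite -e2 mem_pt.
exact: (bgon_middle H hx brx hy bry (st 0%N) (st 1%N) x0 x2 y1).
Qed.

(** Mirror image: left of the cut only the polygon on the last step recurs, so the last list is
    brought to the front before [defect_sum] applies. *)
Let left_defects : \sum_(P <- b1) \sum_(s <- choices (chain_gons sf D v0 1 m.-1))
  defect lam P s = contin (chain_sum R sf D v0) 0 m.-1.
Proof.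
have st := chain_step H bv0.
have b1P P : P \in b1 -> [/\ subgon sf D P, is_bridging P & Low (chain m) \in P].
  by rewrite mem_filter chain_m => /andP[br /(left_homeP H hb)[[hP _ _]]].
case em: (m.-1) => [|m'].
  by rewrite big1 // => P _; rewrite /= big_seq1 defect_notin.
have em2 : m = m'.+2 by rewrite -(prednK m_gt0) em.
have [x [hx brx x0 x1]] := chain_edge_gon m'.+1; rewrite -em2 in x1.
have stm := st m'.+1; rewrite -em2 in stm.
have xb : x \in b1.
  rewrite !mem_filter brx /=; apply/andP; split; last by apply/(gonsP H); rewrite -chain_m.
  have hb1 : bbase D (v0 + n%:Z) (deck sf 1 z0) by have := bbase_deck H 1 hb; rewrite mul1r.
  by apply: (bbase_left H hb1 hx x0); rewrite -chain_m; apply: (bstep_lt H stm).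
have ub : uniq b1 by rewrite !filter_uniq // (gons_uniq H).
rewrite (big_seq_only ub xb); last first.
  move=> y /b1P[hy bry ym] nyx; apply: defect_sum0; apply: contra nyx.
  move=> /(mem_chain_gons H bv0)[k [kt _ _ ky]]; apply/eqP.
  have lt : chain k < chain m by rewrite (chain_ltE H bv0); lia.
  have y1 := bgon_prev H hy bry ky ym lt stm.
  exact: (bgon_edge_uniq H hx brx hy bry stm x0 x1 y1 ym).
rewrite -(natsum_chain R H _ _ bv0).
have -> : chain_gons sf D v0 1 m'.+1 = rcons (chain_gons sf D v0 1 m') (bgons (chain m'.+1)).
  rewrite /chain_gons; have -> : iota 1 m'.+1 = rcons (iota 1 m') m'.+1.
    by rewrite -cats1 -[RHS](iotaD 1 m' 1) addn1.
  exact: map_rcons.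
rewrite big_choices_rcons; last by move=> *; apply: defect_perm.
apply: defect_sum.
- exact: (bgons_uniq H).
- by apply/(bgonsP H).
move=> /(mem_chain_gons H bv0)[k [kt _ _ kx]] y /(bgonsP H)[hy y1 bry].
have lt : chain k < chain m'.+1 by rewrite (chain_ltE H bv0); lia.
have x2 := bgon_prev H hx brx kx x0 lt (st m').
exact: (bgon_middle H hx brx hy bry (st m') stm x2 x1 y1).
Qed.

Lemma sum_window_contin :
  \sum_(s <- choices (window n sf D v0)) class_weight R sf s =
  contin (chain_sum R sf D v0) 0 m.+1 - contin (chain_sum R sf D v0) 1 m.-1.
Proof.
rewrite sum_slots sum_admissible bvertices slots_chain natsum_cons.
have -> : \sum_(P <- b1 ++ b2) lambda R (size P) = chain_sum R sf D v0 m.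
  rewrite /chain_sum chain_m /bridging_sum [RHS]big_mkcond.
  rewrite (home_sum H hb) => [|P]; last by rewrite bridging_deck size_map.
  by rewrite -big_mkcond -[RHS]big_filter filter_cat.
rewrite [X in _ - X]big_cat [X in _ - X]/= left_defects right_defects (natsum_chain R H _ _ bv0) prednK //.
(* The left defect completes the recurrence from length [m] to length [m + 1]; the right defect
   remains as the second term of the trace. *)
have := contin_recr (chain_sum R sf D v0) 0 m.-1; rewrite add0n prednK //.
lra.
Qed.

End StateSum.

Theorem theorem7p6 (R : realType) (n : nat) (n_gt0 : (0 < n)%N)
    (s : nat) (p : 'I_s -> nat) (F : int -> int -> R)
    (sf : surface) (D : set (mpoint * mpoint))
    (hsf : (exists2 m, (0 < m)%N & sf = Annulus n m) \/ sf = PuncturedDisc n)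
    (hD : is_dissection sf D)
    (hF : frieze_pattern F)
    (hper : periodic_quiddity n F)
    (htype : type_Lambda p F)
    (hreal : realizes sf D F) :
  forall i : int,
    principal_growth n F = \sum_(w \in @matchings n sf D i) wtA R sf D w.
Proof.
move=> i; have H := StripDissection n_gt0 hsf hD.
have [v [z b]] := bbase_exists H.
(* Shifting to v0 <= n < v0 + n makes [v0] positive, as the row started at 0 in [growth_chain]
   demands. *)
have [v0 [z0 [hb v0n]]] := bbase_shift H n%:Z b.
have bv0 := bbase_bvertex H hb.
have bn : bvertex sf D (v0 + n%:Z) by have := bvertex_deck H 1 bv0; rewrite mul1r.
have len : v0 <= v0 + n%:Z by lia.
have [m em] := chain_onto H bv0 len bn.
have m0 : (0 < m)%N by case: m em => // /= em; lia.
rewrite (sum_matchings R H) (sum_window R H i v0) (sum_window_contin R H hb m0 em).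
by apply: (growth_chain H hF hper hreal bv0 _ m0 em); lia.
Qed.
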